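(* For any sequence of integers $L=L(n)$ with $1\le L(n)\le n$ satisfying $\limsup_{n\to\infty} L(n)/\sqrt{n}<1$, the hypotheses $H_{1,L}$ are spectrally contiguous with respect to $H_0$. Equivalently, for any sequence of deterministic vectors $\mathbf{v}(n)\in\mathbb{R}^n$ with $\|\mathbf{v}(n)\|_2=1$, and any sequence $\beta=\beta(n)\ge 0$ satisfying $\limsup_{n\to\infty}\beta(n)<1$, the hypotheses $H_{1,\beta}$ are spectrally contiguous with respect to $H_0$.
   Context: For each $n$, let $\mathbf{Z}=\mathbf{Z}(n)=\frac{1}{\sqrt{2n}}(\mathbf{G}+\mathbf{G}^{\mathsf T})$, where $\mathbf{G}$ is an $n\times n$ matrix with i.i.d. entries $\mathbf{G}_{i,j}\sim \mathsf{N}(0,1)$ (so $\mathbf{Z}$ is a GOE matrix: symmetric, with independent entries on and above the diagonal, $\mathbf{Z}_{ij}\sim\mathsf{N}(0,1/n)$ for $i<j$ and $\mathbf{Z}_{ii}\sim\mathsf{N}(0,2/n)$). Consider the following laws for a random symmetric $n\times n$ matrix $\mathbf{X}$: - $H_0$: $\mathbf{X}=\mathbf{Z}$; - $H_{1,\beta}$ (for $\beta=\beta(n)\ge 0$ and deterministic $\mathbf{v}=\mathbf{v}(n)\in\mathbb{R}^n$ with $\|\mathbf{v}\|_2=1$): $\mathbf{X}=\beta\,\mathbf{v}\mathbf{v}^{\mathsf T}+\mathbf{Z}$; - $H_{1,L}$ (for a set $U=U(n)\subseteq[n]$ with $|U|=L$): $\mathbf{X}=\frac{1}{\sqrt n}\mathbf{1}_U\mathbf{1}_U^{\mathsf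 T}+\mathbf{Z}$, where $\mathbf{1}_U$ is the indicator vector of $U$. This is the case $\beta=L/\sqrt n$, $\mathbf{v}=\mathbf{1}_U/\sqrt L$ of $H_{1,\beta}$. The law of the eigenvalues of $\mathbf{X}$ does not depend on the choice of $\mathbf{v}$ (respectively of $U$ with $|U|=L$). Let $Q_0(n)$ (respectively $Q_1(n)$) denote the law of the ordered eigenvalues $(\lambda_1\ge\dots\ge\lambda_n)$ of $\mathbf{X}$ under $H_0$ (respectively under $H_1$, where $H_1$ is $H_{1,\beta}$ or $H_{1,L}$). Contiguity: for each $n$ let $\mathbb{P}_{0,n},\mathbb{P}_{1,n}$ be two probability measures on the same measurable space $(\Omega_n,\mathcal{F}_n)$. The sequence $(\mathbb{P}_{1,n})$ is contiguous with respect to $(\mathbb{P}_{0,n})$ if for any sequence of events $A_n\in\mathcal{F}_n$, $\lim_{n\to\infty}\mathbb{P}_{0,n}(A_n)=0$ implies $\lim_{n\to\infty}\mathbb{P}_{1,n}(A_n)=0$. $H_1$ is called spectrally contiguous with respect to $H_0$ if the sequence $(Q_1(n))$ is contiguous with respect to $(Q_0(n))$. *)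

(* Defs.v *)
From HB Require Import structures.
From mathcomp Require Import all_boot all_order all_algebra.
From mathcomp Require complex.
From mathcomp Require Import all_classical all_reals all_analysis.
From mathcomp Require Import measurable_realfun.

Set Implicit Arguments.
Unset Strict Implicit.
Unset Printing Implicit Defensive.

Import Order.TTheory GRing.Theory Num.Theory.
Import numFieldNormedType.Exports.

Local Open Scope classical_set_scope.
Local Open Scope ring_scope.

Definition is_eigenvalues (R : realType) n (A : 'M[R]_n) (s : n.-tuple R) :
  Prop := sorted >=%O s /\ char_poly A = \prod_(x <- s) ('X - x%:P).

(* The tuple (lambda_1 >= ... >= lambda_n), with multiplicity. The default
   value [nseq_tuple n 0] is only reached when the characteristic polynomial
   does not split over R, never for symmetric A ([eigenvaluesP]). *)
Definition eigenvalues (R : realType) n (A : 'M[R]_n) : n.-tuple R :=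
  xget (nseq_tuple n 0) [set s | is_eigenvalues A s].

Section symmetric_eigenvalues.
Import complex.

Lemma char_poly_conj (F : fieldType) n (P D : 'M[F]_n) : P \in unitmx ->
  char_poly (invmx P *m D *m P) = char_poly D.
Proof.
move=> uP; rewrite /char_poly /char_poly_mx.
have PVP : map_mx polyC (invmx P) *m map_mx polyC P = 1%:M.
  by rewrite -map_mxM mulVmx// map_mx1.
have -> : 'X%:M - map_mx polyC (invmx P *m D *m P) =
    map_mx polyC (invmx P) *m ('X%:M - map_mx polyC D) *m map_mx polyC P.
  rewrite mulmxBr mulmxBl !map_mxM; congr (_ - _).
  by rewrite scalar_mxC -mulmxA PVP mulmx1.
rewrite !det_mulmx mulrAC -det_mulmx PVP det1 mul1r//.
Qed.

Lemma symmetric_eigenvalues (R : realType) n (A : 'M[R]_n) :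
  A^T = A -> exists s : n.-tuple R, is_eigenvalues A s.
Proof.
move=> symA; pose f := real_complex R; pose B : 'M[R[i]]_n := map_mx f A.
have fR x : f x \is Num.real.
  by rewrite complex_real.
have hB : B \is hermsymmx.
  apply: realsym_hermsym.
    apply/is_hermitianmxP; rewrite expr0 scale1r map_mx_id//.
    by rewrite /B map_trmx symA.
  by apply/mxOverP => i j; rewrite mxE.
have /mxOverP dR := hermitian_spectral_diag_real hB.
have /orthomx_spectralP BE := hermitian_normalmx hB.
pose t := [tuple Re (spectral_diag B 0 i) | i < n].
have tE : char_poly A = \prod_(x <- t) ('X - x%:P).
  apply: (map_poly_inj f); rewrite map_char_poly -/B BE.
  rewrite char_poly_conj ?spectral_unit// char_poly_trig; last first.
    by apply/is_trig_mxP => i j ij; rewrite mxE -val_eqE/= ltn_eqF.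
  rewrite rmorph_prod/= big_map big_enum/=; apply: eq_bigr => i _.
  rewrite rmorphB/= map_polyX map_polyC/= mxE eqxx mulr1n.
  by rewrite /f RRe_real.
exists (sort_tuple >=%O t); split; first exact/sort_sorted/ge_total.
by rewrite tE; apply/perm_big; rewrite perm_sym perm_sort.
Qed.
End symmetric_eigenvalues.

Lemma eigenvaluesP (R : realType) n (A : 'M[R]_n) :
  A^T = A -> is_eigenvalues A (eigenvalues A).
Proof. by move=> /symmetric_eigenvalues[s]; exact: xgetI. Qed.

Lemma is_eigenvalues_uniq (R : realType) n (A : 'M[R]_n) (s t : n.-tuple R) :
  is_eigenvalues A s -> is_eigenvalues A t -> s = t.
Proof.
move=> [ss As] [st At]; apply/val_inj/(@sorted_eq _ >=%O) => //.
- exact: ge_trans.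
- exact: ge_anti.
by apply/prod_XsubC_eq; rewrite -As.
Qed.

Section measurability.
Context d (T : measurableType d) (R : realType).

Let measurable_coef (p : T -> {poly R}) :=
  forall k, measurable_fun [set: T] (fun w => (p w)`_k).

Let measurable_coef_cst p : measurable_coef (cst p).
Proof. by move=> k; exact: (measurable_cst (p`_k : R)). Qed.

Let measurable_coefB p q : measurable_coef p -> measurable_coef q ->
  measurable_coef (fun w => p w - q w).
Proof.
move=> mp mq k; under eq_fun do rewrite coefB.
exact: measurable_funB.
Qed.

Let measurable_coefM p q : measurable_coef p -> measurable_coef q ->
  measurable_coef (fun w => p w * q w).
Proof.
move=> mp mq k; under eq_fun do rewrite coefM.
by apply: measurable_sum => i; exact: measurable_funM.
Qed.

Let measurable_coef_sum I (r : seq I) (p : I -> T -> {poly R}) :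
  (forall i, measurable_coef (p i)) ->
  measurable_coef (fun w => \sum_(i <- r) p i w).
Proof.
move=> mp k; under eq_fun do rewrite coef_sum.
by apply: measurable_sum => i; exact: mp.
Qed.

Let measurable_coef_prod I (r : seq I) (p : I -> T -> {poly R}) :
  (forall i, measurable_coef (p i)) ->
  measurable_coef (fun w => \prod_(i <- r) p i w).
Proof.
move=> mp; elim: r => [|i r IH].
  by under eq_fun do rewrite big_nil; exact: measurable_coef_cst.
by under eq_fun do rewrite big_cons; exact: measurable_coefM.
Qed.

Let measurable_char_poly n (X : T -> 'M[R]_n) :
  (forall i j, measurable_fun [set: T] (fun w => X w i j)) ->
  measurable_coef (fun w => char_poly (X w)).
Proof.
move=> mX; rewrite /char_poly /determinant.
apply: measurable_coef_sum => s.
apply: measurable_coefM; first exact: measurable_coef_cst.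
apply: measurable_coef_prod => i.
under eq_fun do rewrite !mxE.
apply: measurable_coefB; first exact: measurable_coef_cst.
move=> k; under eq_fun do rewrite coefC.
case: (k == 0)%N; [exact: mX|exact: (measurable_cst (0 : R))].
Qed.

(* The largest root is < t iff all coefficients of p(X + t) are positive, so it
   is a measurable function of the coefficients of p; then deflate. *)
Let measurable_roots n (s : T -> n.-tuple R) :
  (forall w, sorted >=%O (s w)) ->
  measurable_coef (fun w => \prod_(x <- s w) ('X - x%:P)) ->
  measurable_fun [set: T] s.
Proof.
elim: n s => [|n IH] s s_sorted ms.
  by apply/measurable_fun_tnthP => -[].
pose q w := \prod_(x <- behead_tuple (s w)) ('X - x%:P).
have sE w : s w = [tuple of thead (s w) :: behead_tuple (s w)].
  exact: tuple_eta.
have pE w : \prod_(x <- s w) ('X - x%:P) = ('X - (thead (s w))%:P) * q w.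
  by rewrite {1}sE big_cons.
have max_s w x : x \in tval (s w) -> x <= thead (s w).
  have := s_sorted w; rewrite sE /= theadE => /(order_path_min ge_trans)/allP h.
  by rewrite inE => /predU1P[->//|/h].
have mhead : measurable_fun [set: T] (fun w => thead (s w)).
  apply: (measurability _ (@RGenInftyO.measurableE R)) => _ [_ [t ->] <-].
  rewrite setTI.
  pose p w := (\prod_(x <- s w) ('X - x%:P)) \Po ('X + t%:P).
  have mp : measurable_coef p.
    move=> k; rewrite /p; under eq_fun => w.
      rewrite comp_polyE size_prod_XsubC size_tuple coef_sum; over.
    apply: measurable_sum => i; under eq_fun do rewrite coefZ.
    by apply: measurable_funM => //; exact: ms.
  suff -> : (fun w => thead (s w)) @^-1` `]-oo, t[ =
     \bigcap_(k in `I_n.+2) [set w | 0 < (p w)`_k].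
    apply: bigcap_measurable => // [|k _].
      by exists 0%N.
    have := mp k measurableT `]0, +oo[%classic.
    rewrite setTI => /(_ (measurable_itv _)).
    by congr (measurable _); apply/seteqP; split => w /=; rewrite in_itv/= andbT.
  have p_prod w : p w = \prod_(x <- s w) ('X + (t - x)%:P).
    rewrite /p rmorph_prod/=; apply: eq_bigr => x _.
    by rewrite rmorphB/= comp_polyX comp_polyC polyCB addrA.
  apply/seteqP; split => w /=; rewrite in_itv/=.
    move=> st k kn.
    rewrite /= p_prod.
    have : forall x, x \in tval (s w) -> 0 < t - x.
      by move=> x /max_s xs; rewrite subr_gt0 (le_lt_trans xs).
    have : (k < (size (s w)).+1)%N by rewrite size_tuple.
    elim: (tval (s w)) k {kn} => [|x r IHr] k kr h.
      by rewrite big_nil; case: k kr => // _; rewrite coef1.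
    rewrite big_cons mulrDl coefD coefXM coefCM.
    have hx : 0 < t - x by apply: h; rewrite mem_head.
    have hr y : y \in r -> 0 < t - y by move=> yr; apply: h; rewrite inE yr orbT.
    have sz : size (\prod_(j <- r) ('X + (t - j)%:P)) = (size r).+1.
      rewrite -(size_prod_XsubC r (fun j => j - t)); congr (size (polyseq _)).
      by apply: eq_bigr => j _; rewrite -[in RHS]polyCN opprB.
    case: k kr => [_|k kr] /=.
      by rewrite add0r mulr_gt0// IHr.
    have [kr'|kr'] := ltnP k.+1 (size r).+1.
      by rewrite addr_gt0// ?mulr_gt0// IHr// ltnW.
    by rewrite [X in _ * X]nth_default ?sz// mulr0 addr0 IHr.
  move=> h; rewrite ltNge; apply/negP => ts.
  have : root (p w) (thead (s w) - t).
    rewrite /root horner_comp !hornerE subrK -/(root _ _) root_prod_XsubC.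
    by rewrite sE mem_head.
  have szp : size (p w) = n.+2.
    rewrite p_prod -[in RHS](congr1 S (size_tuple (s w))).
    rewrite -(size_prod_XsubC (s w) (fun j => j - t)).
    by congr (size (polyseq _)); apply: eq_bigr => j _; rewrite -[in RHS]polyCN opprB.
  rewrite /root horner_coef szp => /eqP; apply/eqP; rewrite gt_eqF//.
  rewrite big_ord_recl expr0 mulr1 ltr_pwDl//; first exact: h.
  apply: sumr_ge0 => i _; rewrite mulr_ge0 ?exprn_ge0 ?subr_ge0//.
  by apply/ltW/h => /=; rewrite ltnS.
have mq : measurable_coef q.
  have qn w k : (n < k)%N -> (q w)`_k = 0.
    by move=> nk; rewrite nth_default// size_prod_XsubC size_tuple.
  have qE w k : (q w)`_k = (\prod_(x <- s w) ('X - x%:P))`_k.+1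
      + thead (s w) * (q w)`_k.+1.
    by rewrite pE mulrBl coefB coefXM coefCM/= subrK.
  move=> k; have [m] := ubnP (n.+1 - k)%N.
  elim: m k => // m IHm k km.
  have [nk|kn] := ltnP n k.
    by under eq_fun do rewrite qn//; exact: measurable_cst.
  under eq_fun do rewrite qE.
  apply: measurable_funD; first exact: ms.
  by apply: measurable_funM => //; apply: IHm; rewrite subSS -ltnS -subSn.
have -> : s = (fun w => [tuple of thead (s w) :: behead_tuple (s w)]).
  exact/funext.
apply: measurable_cons => //; apply: IH mq => w.
by have := s_sorted w; rewrite sE/= => /path_sorted.
Qed.

Lemma measurable_eigenvalues n (X : T -> 'M[R]_n) :
  (forall i j, measurable_fun [set: T] (fun w => X w i j)) ->
  (forall w, (X w)^T = X w) ->
  measurable_fun [set: T] (fun w => eigenvalues (X w)).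
Proof.
move=> mX symX.
have H w : is_eigenvalues (X w) (eigenvalues (X w)).
  exact: eigenvaluesP.
apply: measurable_roots => [w|]; first by have [] := H w.
have -> : (fun w => \prod_(x <- eigenvalues (X w)) ('X - x%:P)) =
    fun w => char_poly (X w).
  by apply/funext => w; have [] := H w.
exact: measurable_char_poly.
Qed.

End measurability.

Section random_matrices.
Context d (T : measurableType d) (R : realType) (P : probability T R).

Definition mutually_independent (I : finType) (X : I -> {RV P >-> R}) : Prop :=
  forall (J : {set I}) (A : I -> set R), (forall i, measurable (A i)) ->
    P (\bigcap_(i in [set` J]) X i @^-1` A i) =
    (\prod_(i in J) P (X i @^-1` A i))%E.

Definition standard_normal (X : {RV P >-> R}) : Prop :=
  forall A : set R, measurable A -> distribution P X A = normal_prob 0 1 A.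

Context (n : nat).
Implicit Types (G : 'I_n -> 'I_n -> {RV P >-> R}) (beta : R) (v : 'cV[R]_n).

Definition iid_standard_normal G : Prop :=
  (forall i j, standard_normal (G i j)) /\
  mutually_independent (fun ij : 'I_n * 'I_n => G ij.1 ij.2).

Definition gaussian_mx G (w : T) : 'M[R]_n := \matrix_(i, j) G i j w.

Definition goe_mx G (w : T) : 'M[R]_n :=
  (Num.sqrt (2 * n)%:R)^-1 *: (gaussian_mx G w + (gaussian_mx G w)^T).

Definition spiked_mx beta v G (w : T) : 'M[R]_n :=
  beta *: (v *m v^T) + goe_mx G w.

Definition goe_eigenvalues G (w : T) : n.-tuple R := eigenvalues (goe_mx G w).

Definition spiked_eigenvalues beta v G (w : T) : n.-tuple R :=
  eigenvalues (spiked_mx beta v G w).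

Let tr_goe_mx G w : (goe_mx G w)^T = goe_mx G w.
Proof. by rewrite /goe_mx linearZ/= linearD/= trmxK addrC. Qed.

Let tr_spiked_mx beta v G w : (spiked_mx beta v G w)^T = spiked_mx beta v G w.
Proof. by rewrite /spiked_mx linearD/= linearZ/= trmx_mul trmxK tr_goe_mx. Qed.

Let measurable_goe_mx G i j :
  measurable_fun [set: T] (fun w => goe_mx G w i j).
Proof.
under eq_fun do rewrite !mxE.
by apply: measurable_funM => //; exact: measurable_funD.
Qed.

Let measurable_spiked_mx beta v G i j :
  measurable_fun [set: T] (fun w => spiked_mx beta v G w i j).
Proof.
under eq_fun do rewrite mxE.
by apply: measurable_funD.
Qed.

Let measurable_goe_eigenvalues G : measurable_fun [set: T] (goe_eigenvalues G).
Proof. exact: measurable_eigenvalues. Qed.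

Let measurable_spiked_eigenvalues beta v G :
  measurable_fun [set: T] (spiked_eigenvalues beta v G).
Proof. exact: measurable_eigenvalues. Qed.

HB.instance Definition _ G := isMeasurableFun.Build _ _ _ _
  (goe_eigenvalues G) (measurable_goe_eigenvalues G).

HB.instance Definition _ beta v G := isMeasurableFun.Build _ _ _ _
  (spiked_eigenvalues beta v G) (measurable_spiked_eigenvalues beta v G).

Definition goe_spectral_law G : probability (n.-tuple R) R :=
  distribution P (goe_eigenvalues G).

Definition spiked_spectral_law beta v G : probability (n.-tuple R) R :=
  distribution P (spiked_eigenvalues beta v G).

End random_matrices.

Definition indicator_vec (R : realType) n (U : {set 'I_n}) : 'cV[R]_n :=
  \col_i (i \in U)%:R.

Definition norm2 (R : realType) n (v : 'cV[R]_n) : R :=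
  Num.sqrt (\sum_i v i 0 ^+ 2).

Definition contiguous (R : realType) (d : nat -> measure_display)
    (T : forall n, measurableType (d n))
    (P1 P0 : forall n, probability (T n) R) : Prop :=
  forall A : forall n, set (T n), (forall n, measurable (A n)) ->
    P0 n (A n) @[n --> \oo] --> 0%E -> P1 n (A n) @[n --> \oo] --> 0%E.

Definition spectrally_contiguous (R : realType)
    (Q1 Q0 : forall n, probability (n.-tuple R) R) : Prop :=
  contiguous Q1 Q0.

(* Main.v *)
Require Import Defs.
From HB Require Import structures.
From mathcomp Require Import all_boot all_order all_algebra.
From mathcomp Require Import all_classical all_reals all_analysis.
From mathcomp Require Import measurable_realfun ring.
Set Implicit Arguments.
Unset Strict Implicit.
Unset Printing Implicit Defensive.
Import Order.TTheory GRing.Theory Num.Theory.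
Import numFieldNormedType.Exports.

Local Open Scope classical_set_scope.
Local Open Scope ring_scope.

(* Rotating the rows and columns of [G] does not change its law, so the
   spectral law of [beta v v^T + Z] does not depend on the unit vector [v]; it
   is therefore its average over the [2^n] vectors [v = e / sqrt n] with signs
   [e]. By the Cameron-Martin formula, its density with respect to the null
   spectral law is the conditional expectation of the average [L] of the
   likelihood ratios of [G + M_e], [M_e = beta / sqrt (2n) e e^T]. Since
   [E (L_e L_e') = exp <M_e, M_e'> = exp (beta^2 / (2n) <e, e'>^2)], the second
   moment of [L] is an average over signs, which Gaussian linearisation of the
   square and [cosh a <= exp (a^2 / 2)] bound by [(1 - beta^2)^(-1/2)]. A
   uniformly bounded second moment gives contiguity. *)

(** * The standard Gaussian measure on the line *)

Section density.
Local Open Scope ereal_scope.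
Context d (T : measurableType d) (R : realType).
Variables (m nu : {measure set T -> \bar R}) (g : T -> R).
Hypothesis mg : measurable_fun [set: T] g.
Hypothesis g0 : forall x, (0 <= g x)%R.
Hypothesis mE : forall A, measurable A -> m A = \int[nu]_(x in A) (g x)%:E.

Import HBNNSimple.

Let integral_density_indic A : measurable A ->
  \int[m]_x (\1_A x)%:E = \int[nu]_x ((\1_A x)%:E * (g x)%:E).
Proof.
move=> mA; rewrite integral_indic// setIT mE// integral_mkcond.
apply: eq_integral => x _; rewrite patchE indicE.
by case: (x \in A); rewrite ?mul1e ?mul0e.
Qed.

Let integral_density_nnsfun (f : {nnsfun T >-> R}) :
  \int[m]_x (f x)%:E = \int[nu]_x ((f x)%:E * (g x)%:E).
Proof.
under [LHS]eq_integral do rewrite fimfunE -fsumEFin//.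
rewrite [LHS]ge0_integral_fsum//; last 2 first.
  - by move=> r; exact/measurable_EFinP/measurableT_comp.
  - by move=> n x _; rewrite EFinM nnfun_muleindic_ge0.
under [RHS]eq_integral.
  move=> x xD; rewrite fimfunE -fsumEFin// muleC ge0_mule_fsumr; last first.
    by move=> r; rewrite EFinM nnfun_muleindic_ge0.
  over.
rewrite [RHS]ge0_integral_fsum//; last 2 first.
  - move=> r; apply: emeasurable_funM; first exact/measurable_EFinP.
    by apply/measurable_EFinP; do 2 apply/measurableT_comp => //.
  - move=> n x _; rewrite EFinM mule_ge0//; last by rewrite nnfun_muleindic_ge0.
    by rewrite lee_fin.
apply: eq_fsbigr => r _.
(* Only values [r > 0] contribute: the preimage of a negative value under a nonnegative function is
   empty. *)
have [->|r0] := eqVneq r 0%R.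
  by rewrite !integral0_eq// => x _; rewrite mul0r ?mule0.
have [r1|r1] := ltP r 0%R.
  by rewrite preimage_nnfun0// indic0 !integral0_eq// => x _; rewrite mulr0 ?mule0.
under eq_integral do rewrite EFinM.
rewrite ge0_integralZl_EFin//; last exact/measurable_EFinP/measurable_indic.
rewrite integral_density_indic// -ge0_integralZl_EFin//.
- by apply: eq_integral => x _; rewrite EFinM [RHS]muleC muleA.
- by move=> x _; rewrite mule_ge0// lee_fin.
- by apply: emeasurable_funM; exact/measurable_EFinP.
Qed.

(** The identity holds for indicators by [mE], for simple functions by linearity, and in general by
    monotone convergence along simple approximations. *)
Lemma ge0_integral_density (f : T -> \bar R) :
  measurable_fun [set: T] f -> (forall x, 0 <= f x) ->
  \int[m]_x f x = \int[nu]_x (f x * (g x)%:E).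
Proof.
move=> mf f0; pose f_ := nnsfun_approx measurableT mf.
transitivity (limn (fun n => \int[m]_x (f_ n x)%:E)).
  rewrite -monotone_convergence//=.
  - apply: eq_integral => x _; apply/esym/cvg_lim => //.
    exact: cvg_nnsfun_approx.
  - by move=> n; exact/measurable_EFinP.
  - by move=> n x _; rewrite lee_fin.
  - by move=> x _ a b ab; rewrite lee_fin; exact/lefP/nd_nnsfun_approx.
under eq_fun do rewrite integral_density_nnsfun.
rewrite -monotone_convergence//=.
- apply: eq_integral => x _; apply/cvg_lim => //.
  by apply: cvgeZr => //; exact: cvg_nnsfun_approx.
- by move=> n; apply: emeasurable_funM; exact/measurable_EFinP.
- by move=> n x _; rewrite mule_ge0// lee_fin.
- move=> x _ a b ab; rewrite lee_pmul ?lee_fin//.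
  exact/lefP/nd_nnsfun_approx.
Qed.

End density.

Section gaussian_line.
Context (R : realType).
Local Notation mu := (@lebesgue_measure R).
Local Notation gamma := (@normal_prob R 0 1).
Local Notation phi := (@normal_pdf R 0 1).

(** Lebesgue measure is determined by its values on the intervals []b, c]], whose length a
    translation keeps. *)
Lemma lebesgue_measureD (a : R) (A : set R) : measurable A ->
  pushforward mu ((fun x => x + a) : _ -> measurableTypeR R) A = mu A.
Proof.
move=> mA; apply/esym/lebesgue_measure_unique => //=.
  exact: measurable_funD.
move=> mf _ [[b c]] _ <-.
rewrite /pushforward/=.
rewrite (_ : _ @^-1` _ = `]b - a, c - a]%classic); last first.
  by apply/seteqP; split => x /=; rewrite !in_itv/= ltrBlDr lerBrDr.
rewrite !lebesgue_measure_itv/= !lte_fin ltrD2r; case: ifP => // _.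
by rewrite -!EFinD; congr (_%:E); ring.
Qed.

Lemma ge0_integralT_shift (a : R) (f : R -> \bar R) :
  measurable_fun [set: R] f -> (forall x, 0 <= f x)%E ->
  (\int[mu]_x f (x + a)%R = \int[mu]_x f x)%E.
Proof.
move=> mf f0.
pose sh : measurableTypeR R -> measurableTypeR R := fun x => x + a.
have ma : measurable_fun setT sh by exact: measurable_funD.
have := @ge0_integral_pushforward _ _ _ _ R sh ma mu setT f measurableT mf.
rewrite preimage_setT => <-; last by move=> x _.
by apply: eq_measure_integral => A mA _; exact: lebesgue_measureD.
Qed.

Lemma ge0_integral_gaussian (f : R -> \bar R) :
  measurable_fun [set: R] f -> (forall x, 0 <= f x)%E ->
  (\int[gamma]_x f x = \int[mu]_x (f x * (phi x)%:E))%E.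
Proof.
move=> mf f0; apply: ge0_integral_density => //.
- exact: measurable_normal_pdf.
- by move=> x; exact: normal_pdf_ge0.
Qed.

Lemma std_normal_pdfE (x : R) : phi x = normal_peak 1 * expR (- x ^+ 2 / 2).
Proof. by rewrite normal_pdfE ?oner_neq0// /normal_fun subr0 expr1n. Qed.

(** One-dimensional Cameron-Martin formula: translate the Lebesgue integral by [a] and use [phi x =
    phi (x + a) * expR (a * (x + a) - a ^+ 2 / 2)]. *)
Lemma gaussian_shift (a : R) (f : R -> \bar R) :
  measurable_fun [set: R] f -> (forall x, 0 <= f x)%E ->
  (\int[gamma]_x f (x + a)%R =
   \int[gamma]_x (f x * (expR (a * x - a ^+ 2 / 2))%:E))%E.
Proof.
move=> mf f0; rewrite ge0_integral_gaussian//; last first.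
  by apply: (measurableT_comp mf); exact: measurable_funD.
rewrite ge0_integral_gaussian//; last 2 first.
- apply: emeasurable_funM => //; apply/measurable_EFinP.
  apply: measurableT_comp => //; exact: measurable_funB.
- by move=> x; rewrite mule_ge0// lee_fin expR_ge0.
rewrite -[RHS](ge0_integralT_shift a); last 2 first.
- apply: emeasurable_funM; last by apply/measurable_EFinP; exact: measurable_normal_pdf.
  apply: emeasurable_funM => //; apply/measurable_EFinP.
  apply: measurableT_comp => //; exact: measurable_funB.
- by move=> x; rewrite !mule_ge0// lee_fin ?expR_ge0 ?normal_pdf_ge0.
apply: eq_integral => x _; rewrite -muleA -EFinM; congr (_ * _%:E)%E.
rewrite !std_normal_pdfE mulrCA -expRD; congr (_ * expR _).
by field.
Qed.

Lemma gaussian_mgf (a : R) :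
  (\int[gamma]_x (expR (a * x))%:E = (expR (a ^+ 2 / 2))%:E)%E.
Proof.
have ma : measurable_fun [set: R] (fun x : R => expR (a * x - a ^+ 2 / 2)).
  apply: measurableT_comp => //; exact: measurable_funB.
(* The shift formula for the constant 1 says that the exponential tilt has total mass one. *)
have h : (\int[gamma]_x (expR (a * x - a ^+ 2 / 2))%:E = 1)%E.
  have := @gaussian_shift a (cst 1%E) (@measurable_cst _ _ _ _ _ _) (fun=> lee01).
  have -> : (\int[gamma]_x cst 1 (x + a)%R = 1)%E.
    by rewrite integral_cst//= mul1e; exact: probability_setT.
  move=> ->.
  by apply: eq_integral => x _; rewrite mul1e.
transitivity ((expR (a ^+ 2 / 2))%:E * \int[gamma]_x (expR (a * x - a ^+ 2 / 2))%:E)%E.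
  rewrite -ge0_integralZl_EFin ?expR_ge0//.
  - by apply: eq_integral => x _; rewrite -EFinM -expRD addrC subrK.
  - exact/measurable_EFinP.
by rewrite h mule1.
Qed.

(** The integrand times [phi] is [s] times the centred normal density of standard deviation
    [s = (1 - b)^(-1/2)], which has mass one. *)
Lemma gaussian_exp_sqr (b : R) : b < 1 ->
  (\int[gamma]_x (expR (b * x ^+ 2 / 2))%:E = ((Num.sqrt (1 - b))^-1)%:E)%E.
Proof.
move=> b1; have b0 : 0 < 1 - b by rewrite subr_gt0.
pose s := (Num.sqrt (1 - b))^-1.
have s0 : 0 < s by rewrite invr_gt0 sqrtr_gt0.
have s2 : s ^+ 2 = (1 - b)^-1 by rewrite exprVn sqr_sqrtr// ltW.
have mb : measurable_fun [set: R] (fun x : R => expR (b * x ^+ 2 / 2)).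
  apply: measurableT_comp => //; apply: measurable_funM => //.
  by apply: measurable_funM => //; exact: measurable_funX.
rewrite ge0_integral_gaussian//; last exact/measurable_EFinP.
transitivity (\int[mu]_x (s%:E * (normal_pdf 0 s x)%:E))%E; last first.
  rewrite ge0_integralZl_EFin ?integral_normal_pdf ?mule1 ?ltW//.
  - by move=> x _; rewrite lee_fin normal_pdf_ge0.
  - by apply/measurable_EFinP; exact: measurable_normal_pdf.
apply: eq_integral => x _; rewrite -!EFinM; congr _%:E.
have -> : normal_pdf 0 s x = normal_peak s * expR (- (x - 0) ^+ 2 / (s ^+ 2 *+ 2)).
  by rewrite normal_pdfE// gt_eqF.
rewrite std_normal_pdfE mulrCA -expRD [RHS]mulrA; congr (_ * expR _).
  rewrite /normal_peak expr1n mul1r -mulrnAr sqrtrM ?sqr_ge0// sqrtr_sqr gtr0_norm//.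
  by rewrite invfM mulrA divff ?mul1r// gt_eqF.
by rewrite subr0 s2 -mulr_natr; field; rewrite gt_eqF.
Qed.

End gaussian_line.

(** * Rotation invariance in the plane *)

Section gaussian_plane.
Context (R : realType).
Local Notation mu := (@lebesgue_measure R).
Local Notation gamma := (@normal_prob R 0 1).
Local Notation phi := (@normal_pdf R 0 1).
Implicit Types F : R * R -> \bar R.

Let measurable_pdf2 : measurable_fun [set: R * R] (fun p => phi p.1 * phi p.2).
Proof.
apply: measurable_funM.
  apply: (measurableT_comp (f := phi) (g := fst)) => //.
  exact: measurable_normal_pdf.
apply: (measurableT_comp (f := phi) (g := snd)) => //.
exact: measurable_normal_pdf.
Qed.

Lemma lebesgue2_shear_snd (b : R) F :
  measurable_fun [set: R * R] F -> (forall p, 0 <= F p)%E ->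
  (\int[mu]_x \int[mu]_y F (x, y + b * x)%R = \int[mu]_x \int[mu]_y F (x, y))%E.
Proof.
move=> mF F0; apply: eq_integral => x _.
rewrite (ge0_integralT_shift (b * x) (f := fun y => F (x, y)))//.
exact: measurableT_comp.
Qed.

(** Tonelli makes [x] the inner variable; for fixed [y] the shear is then a translation. *)
Lemma lebesgue2_shear_fst (a : R) F :
  measurable_fun [set: R * R] F -> (forall p, 0 <= F p)%E ->
  (\int[mu]_x \int[mu]_y F (x + a * y, y)%R = \int[mu]_x \int[mu]_y F (x, y))%E.
Proof.
move=> mF F0.
have mS : measurable_fun [set: R * R] (fun p : R * R => F (p.1 + a * p.2, p.2)).
  apply: (measurableT_comp mF); apply: measurable_fun_pair => //=.
  by apply: measurable_funD => //; exact: measurable_funM.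
have := fubini_tonelli (m1 := mu) (m2 := mu) _ mS (fun=> F0 _).
move=> /= ->.
have := fubini_tonelli (m1 := mu) (m2 := mu) _ mF F0.
move=> /= ->.
apply: eq_integral => y _ /=.
rewrite (ge0_integralT_shift (a * y) (f := fun x => F (x, y)))//.
exact: measurableT_comp.
Qed.

Lemma ge0_integral_gaussian2 F :
  measurable_fun [set: R * R] F -> (forall p, 0 <= F p)%E ->
  (\int[gamma]_x \int[gamma]_y F (x, y) =
   \int[mu]_x \int[mu]_y (F (x, y) * (phi x * phi y)%:E))%E.
Proof.
move=> mF F0; rewrite ge0_integral_gaussian; last 2 first.
- exact: (measurable_fun_fubini_tonelli_F (m2 := gamma) F).
- by move=> x; apply: integral_ge0.
apply: eq_integral => x _.
have mFx : measurable_fun [set: R] (fun y => F (x, y)) by exact: measurableT_comp.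
have mphi : measurable_fun [set: R] (fun y => (phi y)%:E).
  by apply/measurable_EFinP; exact: measurable_normal_pdf.
rewrite ge0_integral_gaussian// muleC -ge0_integralZl_EFin ?normal_pdf_ge0//.
- by apply: eq_integral => y _; rewrite EFinM muleCA.
- by move=> y _; rewrite mule_ge0// lee_fin normal_pdf_ge0.
- exact: emeasurable_funM.
Qed.

(* A rotation is the product of the shears [x + a y], [y - s x], [x + a y] with
   [a = (1 - c) / s], each of which preserves the Lebesgue measure. *)
Lemma gaussian_rotation (c s : R) F : c ^+ 2 + s ^+ 2 = 1 -> s != 0 ->
  measurable_fun [set: R * R] F -> (forall p, 0 <= F p)%E ->
  (\int[gamma]_x \int[gamma]_y F (c * x + s * y, c * y - s * x)%R =
   \int[gamma]_x \int[gamma]_y F (x, y))%E.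
Proof.
move=> cs1 s0 mF F0; pose a := (1 - c) / s.
have mrot : measurable_fun [set: R * R]
    (fun p : R * R => F (c * p.1 + s * p.2, c * p.2 - s * p.1)).
  apply: (measurableT_comp mF); apply: measurable_fun_pair => /=.
    by apply: measurable_funD; exact: measurable_funM.
  by apply: measurable_funB; exact: measurable_funM.
have := ge0_integral_gaussian2 mrot (fun=> F0 _).
move=> /= ->.
have := ge0_integral_gaussian2 mF F0.
move=> /= ->.
pose H0 p := (F p * (phi p.1 * phi p.2)%:E)%E.
have mH0 : measurable_fun [set: R * R] H0.
  by apply: emeasurable_funM => //; exact/measurable_EFinP.
have H00 p : (0 <= H0 p)%E by rewrite mule_ge0// lee_fin mulr_ge0 ?normal_pdf_ge0.
(* [H1] and [H2] precompose the weighted integrand with the last shear, then with the last two; the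
   first one is left inside the integral. *)
pose H1 p := H0 (p.1 + a * p.2, p.2).
have mH1 : measurable_fun [set: R * R] H1.
  apply: (measurableT_comp mH0); apply: measurable_fun_pair => //=.
  by apply: measurable_funD => //; exact: measurable_funM.
pose H2 p := H1 (p.1, p.2 - s * p.1).
have mH2 : measurable_fun [set: R * R] H2.
  apply: (measurableT_comp mH1); apply: measurable_fun_pair => //=.
  by apply: measurable_funB => //; exact: measurable_funM.
transitivity (\int[mu]_x \int[mu]_y H2 (x + a * y, y)%R)%E.
  apply: eq_integral => x _; apply: eq_integral => y _.
  rewrite /H2 /H1 /H0 /=.
  have e1 : y - s * (x + a * y) = c * y - s * x by rewrite /a; field.
  have e2 : x + a * y + a * (y - s * (x + a * y)) = c * x + s * y.
    have -> : x + a * y + a * (y - s * (x + a * y)) =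
      c * x + (1 - c ^+ 2) / s * y by rewrite /a; field.
    have -> : 1 - c ^+ 2 = s * s by rewrite -cs1; ring.
    by rewrite mulfK.
  rewrite e2 e1; congr (_ * _%:E)%E.
  (* The Gaussian weight depends on [x ^+ 2 + y ^+ 2] only, which the rotation fixes since
     [c ^+ 2 + s ^+ 2 = 1]. *)
  rewrite !std_normal_pdfE mulrACA [RHS]mulrACA -!expRD; congr (_ * expR _).
  by rewrite -[LHS]mulr1 -cs1; field; rewrite cs1 oner_neq0.
apply: (etrans (lebesgue2_shear_fst a mH2 (fun=> H00 _))).
transitivity (\int[mu]_x \int[mu]_y H1 (x, y + (- s) * x)%R)%E.
  by apply: eq_integral => x _; apply: eq_integral => y _; rewrite /H2 mulNr.
apply: (etrans (lebesgue2_shear_snd (- s) mH1 (fun=> H00 _))).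
exact: (lebesgue2_shear_fst a mH0 H00).
Qed.

End gaussian_plane.

(** * Gaussian vectors *)

Section coordinates.
Context (R : realType) (I : finType).

Definition box (A : I -> set R) : set (I -> R) := [set w | forall i, A i (w i)].

Definition boxes : set (set (I -> R)) :=
  [set B | exists2 A : I -> set R, (forall i, measurable (A i)) & B = box A].

(** The product sigma-algebra on [I -> R]. Its generators, the boxes, are stable under intersection,
    so a probability on it is determined by its values on boxes. *)
Definition coords := g_sigma_algebraType boxes.

Definition upd (w : I -> R) (j : I) (x : R) : I -> R :=
  fun i => if i == j then x else w i.

Lemma measurable_box (A : I -> set R) :
  (forall i, measurable (A i)) -> measurable (box A : set coords).
Proof. by move=> mA; apply: sub_sigma_algebra; exists A. Qed.

Lemma measurable_coord (i : I) : measurable_fun [set: coords] (fun w => w i).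
Proof.
move=> _ B mB; rewrite setTI.
rewrite (_ : _ @^-1` _ = box (fun k => if k == i then B else setT)).
  by apply: measurable_box => k; case: ifP.
apply/seteqP; split => w /=.
  by move=> Bwi k; case: eqP => // ->.
by move=> /(_ i); rewrite eqxx.
Qed.

Lemma measurable_coordsP d (T : measurableType d) (f : T -> coords) :
  (forall i, measurable_fun [set: T] (fun t => f t i)) -> measurable_fun [set: T] f.
Proof.
move=> mf; apply: (@measurability _ _ T coords setT f boxes erefl) => _ [_ [A mA ->] <-].
rewrite setTI (_ : f @^-1` _ = \bigcap_(i in [set: I]) (fun t => f t i) @^-1` A i).
  apply: fin_bigcap_measurable => [|i _]; first exact: finite_finset.
  by rewrite -[X in measurable X]setTI; exact: mf.
by apply/seteqP; split => t /=; [move=> h i _|move=> h i]; exact: h.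
Qed.

Lemma measurable_upd (j : I) d (T : measurableType d) (f : T -> coords) (g : T -> R) :
  measurable_fun [set: T] f -> measurable_fun [set: T] g ->
  measurable_fun [set: T] (fun t => upd (f t) j (g t) : coords).
Proof.
move=> mf mg; apply: measurable_coordsP => i; rewrite /upd.
case: eqP => // _; apply: (measurableT_comp (f := fun w : coords => w i)) mf.
exact: measurable_coord.
Qed.

Local Notation gamma := (@normal_prob R 0 1).

(** A characterisation rather than a construction: it will be applied to the joint law of the
    entries of [G], which is already given. *)
Definition std_gaussian (m : set coords -> \bar R) := forall A : I -> set R,
  (forall i, measurable (A i)) -> m (box A) = (\prod_i gamma (A i))%E.

Lemma std_gaussian_unique (m1 m2 : {measure set coords -> \bar R}) :
  std_gaussian m1 -> std_gaussian m2 -> forall B, measurable B -> m1 B = m2 B.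
Proof.
move=> g1 g2 B mB; apply: (@measure_unique _ R coords boxes (fun=> setT)) => //.
- move=> _ _ [A mA ->] [{mB}B mB ->]; exists (fun i => A i `&` B i).
    by move=> i; exact: measurableI.
  apply/seteqP; split => w /=; first by move=> [a b] i; split; [exact: a|exact: b].
  by move=> ab; split => i; have [] := ab i.
- by move=> _; exists (fun=> setT) => //; apply/seteqP; split.
- by apply/seteqP; split => // w _; exists 0%N.
- by move=> _ [A mA ->]; rewrite g1// g2.
- move=> _; have -> : setT = box (fun=> setT) by apply/seteqP; split.
  rewrite g1// big1 ?ltry// => i _; exact: probability_setT.
Qed.

End coordinates.

Section standard_gaussian.
Context (R : realType) (I : finType) (m : probability (coords R I) R).
Hypothesis gm : std_gaussian m.
Local Notation gamma := (@normal_prob R 0 1).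
Local Notation coords := (coords R I).

(** Replacing coordinate [j] by an independent standard normal gives a law with the same values on
    boxes, hence the same law. This isolates one coordinate and reduces statements about [m] to
    integrals on the line. *)
Lemma gaussian_resample (j : I) (f : coords -> \bar R) :
  measurable_fun [set: coords] f -> (forall w, 0 <= f w)%E ->
  (\int[m]_w f w = \int[m]_w \int[gamma]_x f (upd w j x))%E.
Proof.
move=> mf f0.
pose h (p : coords * R) : coords := upd p.1 j p.2.
have mh : measurable_fun setT h by apply: measurable_upd.
have h_gaussian : std_gaussian (pushforward (m \x gamma)%E h).
  move=> A mA; rewrite /pushforward.
  (* The old coordinate [j] is overwritten, hence unconstrained; the constraint [A j] falls on the
     fresh sample. *)
  rewrite (_ : h @^-1` _ = box (fun i => if i == j then setT else A i) `*` A j).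
    have mA' i : measurable (if i == j then setT else A i) by case: ifP.
    have -> : (m \x gamma)%E (box (fun i => if i == j then setT else A i) `*` A j) =
        (\prod_i gamma (if i == j then setT else A i) * gamma (A j))%E.
      rewrite -(gm mA').
      exact: (product_measure1E m gamma (measurable_box mA') (mA j)).
    rewrite (bigD1 j)//= eqxx [X in (X * _ * _)%E]probability_setT mul1e muleC.
    rewrite [RHS](bigD1 j)//=; congr (_ * _)%E; apply: eq_bigr => i /negPf ij.
    by rewrite ij.
  apply/seteqP; split => -[w x] /=; rewrite /h /upd /=.
    by move=> hA; split => [i|]; [have := hA i; case: eqP|have := hA j; rewrite eqxx].
  by move=> [hA Ax] i; have := hA i; case: eqP => // ->.
transitivity (\int[pushforward (m \x gamma)%E h]_w f w)%E.
  by apply: eq_measure_integral => A mA _; exact: std_gaussian_unique.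
rewrite ge0_integral_pushforward// preimage_setT.
have mfh : measurable_fun setT (f \o h) by exact: measurableT_comp.
exact: (fubini_tonelli1 (m1 := m) (m2 := gamma) _ mfh (fun=> f0 _)).
Qed.

Lemma gaussian_shift_coord (j : I) (a : R) (f : coords -> \bar R) :
  measurable_fun [set: coords] f -> (forall w, 0 <= f w)%E ->
  (\int[m]_w f (upd w j (w j + a)%R) =
   \int[m]_w (f w * (expR (a * w j - a ^+ 2 / 2))%:E))%E.
Proof.
move=> mf f0.
have mj : measurable_fun setT (fun w : coords => w j) := measurable_coord j.
have me : measurable_fun [set: R] (fun x : R => (expR (a * x - a ^+ 2 / 2))%:E).
  apply/measurable_EFinP; apply: measurableT_comp => //; exact: measurable_funB.
rewrite (gaussian_resample j); last 2 first.
- by apply: measurableT_comp mf _; apply: measurable_upd => //; exact: measurable_funD.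
- by move=> w.
rewrite [RHS](gaussian_resample j); last 2 first.
- apply: emeasurable_funM => //; exact: (measurableT_comp me mj).
- by move=> w; rewrite mule_ge0// lee_fin expR_ge0.
apply: eq_integral => w _.
have mfw : measurable_fun [set: R] (fun x => f (upd w j x)).
  by apply: measurableT_comp mf _; apply: measurable_upd => //; exact: measurable_cst.
transitivity (\int[gamma]_x f (upd w j (x + a)%R))%E.
  apply: eq_integral => x _; congr f; apply/funext => i; rewrite /upd eqxx.
  by case: eqP.
apply: (etrans (gaussian_shift a mfw (fun=> f0 _))).
by apply: eq_integral => x _; rewrite /upd eqxx.
Qed.

(** The coordinates are shifted one at a time along a duplicate-free list. *)
Lemma cameron_martin (M : I -> R) (f : coords -> \bar R) :
  measurable_fun [set: coords] f -> (forall w, 0 <= f w)%E ->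
  (\int[m]_w f (fun i => w i + M i)%R =
   \int[m]_w (f w * (expR (\sum_i (M i * w i - M i ^+ 2 / 2)))%:E))%E.
Proof.
move=> mf f0.
suff H (s : seq I) : uniq s ->
    (\int[m]_w f (fun i => w i + (if i \in s then M i else 0))%R =
    \int[m]_w (f w * (expR (\sum_(i <- s) (M i * w i - M i ^+ 2 / 2)))%:E))%E.
  rewrite -(H _ (index_enum_uniq I)); apply: eq_integral => w _.
  by congr f; apply/funext => i; rewrite mem_index_enum.
elim: s f mf f0 => [|j s IH] f mf f0 /=.
  move=> _; apply: eq_integral => w _; rewrite big_nil expR0 mule1; congr f.
  by apply/funext => i; rewrite addr0.
move=> /andP[js us].
have ms : measurable_fun setT
    (fun w : coords => (fun i => w i + (if i \in s then M i else 0))%R : coords).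
  apply: measurable_coordsP => i; apply: measurable_funD => //.
  exact: measurable_coord.
have me : measurable_fun [set: coords] (fun w => (expR (M j * w j - M j ^+ 2 / 2))%:E).
  apply/measurable_EFinP; apply: measurableT_comp => //; apply: measurable_funB => //.
  by apply: measurable_funM => //; exact: measurable_coord.
(* The weight produced by coordinate [j] is absorbed into the integrand. The later shifts leave it
   alone because [j] is not in [s]. *)
pose g (w : coords) : \bar R := (f w * (expR (M j * w j - M j ^+ 2 / 2))%:E)%E.
have mg : measurable_fun setT g by exact: emeasurable_funM.
have g0 w : (0 <= g w)%E by rewrite mule_ge0// lee_fin expR_ge0.
transitivity (\int[m]_w g (fun i => w i + (if i \in s then M i else 0))%R)%E.
  transitivity (\int[m]_w f (fun i =>
     upd w j (w j + M j)%R i + (if i \in s then M i else 0))%R)%E.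
    apply: eq_integral => w _; congr f; apply/funext => i; rewrite /upd inE.
    by case: eqP => //= ->; rewrite (negPf js) addr0.
  have mfs := measurableT_comp mf ms.
  apply: (etrans (gaussian_shift_coord j (M j) mfs (fun=> f0 _))).
  by apply: eq_integral => w _; rewrite /g /= (negPf js) addr0.
apply: (etrans (IH g mg g0 us)); apply: eq_integral => w _.
by rewrite /g big_cons -muleA -EFinM -expRD.
Qed.

Definition rot2 (i j : I) (c s : R) (w : I -> R) : I -> R :=
  upd (upd w i (c * w i + s * w j)) j (c * w j - s * w i).

Lemma measurable_rot2 (i j : I) (c s : R) :
  measurable_fun [set: coords] (rot2 i j c s : coords -> coords).
Proof.
have mi k : measurable_fun setT (fun w : coords => w k) := measurable_coord k.
apply: measurable_upd; first apply: measurable_upd => //.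
  by apply: measurable_funD; exact: measurable_funM.
by apply: measurable_funB; exact: measurable_funM.
Qed.

(** After resampling both coordinates, this is the rotation invariance of the plane Gaussian, with
    the other coordinates frozen. *)
Lemma gaussian_rot2 (i j : I) (c s : R) (f : coords -> \bar R) :
  i != j -> c ^+ 2 + s ^+ 2 = 1 -> s != 0 ->
  measurable_fun [set: coords] f -> (forall w, 0 <= f w)%E ->
  (\int[m]_w f (rot2 i j c s w) = \int[m]_w f w)%E.
Proof.
move=> ij cs1 s0.
have resample2 g : measurable_fun [set: coords] g -> (forall w, 0 <= g w)%E ->
    (\int[m]_w g w = \int[m]_w \int[gamma]_x \int[gamma]_y g (upd (upd w i x) j y))%E.
  move=> mg g0; apply: (etrans (gaussian_resample j mg g0)).
  pose G (p : coords * R) := g (upd p.1 j p.2).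
  have mG : measurable_fun setT G.
    by apply: measurableT_comp mg _; exact: measurable_upd.
  have mG1 := measurable_fun_fubini_tonelli_F (m2 := gamma) G mG (fun=> g0 _).
  by apply: (gaussian_resample i mG1) => w; apply: integral_ge0 => x _; exact: g0.
move=> mf f0.
have mfr := measurableT_comp mf (measurable_rot2 i j c s).
apply: (etrans (resample2 _ mfr (fun=> f0 _))).
apply: (etrans _ (esym (resample2 _ mf f0))); apply: eq_integral => w _.
pose F (p : R * R) := f (upd (upd w i p.1) j p.2).
have mF : measurable_fun setT F.
  apply: measurableT_comp mf _; apply: measurable_upd => //.
  by apply: measurable_upd => //; exact: measurable_cst.
apply: (etrans _ (gaussian_rotation cs1 s0 mF (fun=> f0 _))).
apply: eq_integral => x _; apply: eq_integral => y _; rewrite /F /=; congr f.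
apply/funext => k; rewrite /rot2 /upd !eqxx (negPf ij).
by case: (k =P j) => // _; case: (k =P i).
Qed.

End standard_gaussian.

(** * Rotation invariance of the spectrum *)

Lemma eigenvalues_similar (R : realType) n (A P Q : 'M[R]_n) :
  P *m Q = 1%:M -> eigenvalues (P *m A *m Q) = eigenvalues A.
Proof.
move=> PQ; have [_ uQ] := mulmx1_unit PQ.
have -> : P = invmx Q by rewrite -[P]mulmx1 -(mulmxV uQ) mulmxA PQ mul1mx.
by rewrite /eigenvalues /is_eigenvalues char_poly_conj.
Qed.

(** * Givens rotations *)

Section givens.
Context (R : realType) (n : nat).
Implicit Types (i j k : 'I_n) (c s : R).

(** Oriented so that left multiplication acts on rows [i] and [j] of each column exactly as [rot2]
    does. *)
Definition givens i j c s : 'M[R]_n := \matrix_(k, l)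
  if k == j then c * (l == j)%:R - s * (l == i)%:R
  else if k == i then c * (l == i)%:R + s * (l == j)%:R
  else (l == k)%:R.

Lemma givensE i j c s p (A : 'M[R]_(n, p)) k l :
  (givens i j c s *m A) k l =
  if k == j then c * A j l - s * A i l
  else if k == i then c * A i l + s * A j l
  else A k l.
Proof.
have sumE (h : 'I_n) : \sum_(u < n) (u == h)%:R * A u l = A h l.
  rewrite (bigD1 h)//= eqxx mul1r big1 ?addr0// => u /negPf ->.
  by rewrite mul0r.
rewrite mxE; under eq_bigr do rewrite mxE.
case: (k == j); last case: (k == i) => //.
- under eq_bigr do rewrite mulrBl -!mulrA.
  by rewrite sumrB -!mulr_sumr !sumE.
- under eq_bigr do rewrite mulrDl -!mulrA.
  by rewrite big_split/= -!mulr_sumr !sumE.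
Qed.

Lemma givensT i j c s : i != j -> (givens i j c s)^T = givens i j c (- s).
Proof.
move=> /eqP ij; apply/matrixP => k l; rewrite !mxE.
case: (eqVneq k l) => [<-|/eqP kl]; case: (eqVneq k j) => [kj|/eqP kj];
  case: (eqVneq k i) => [ki|/eqP ki]; try congruence; try (by rewrite /=; ring);
  case: (eqVneq l j) => [lj|/eqP lj]; case: (eqVneq l i) => [li|/eqP li];
  try congruence; by rewrite /=; ring.
Qed.

Lemma givens_mulT i j c s : i != j -> c ^+ 2 + s ^+ 2 = 1 ->
  givens i j c s *m (givens i j c s)^T = 1%:M.
Proof.
move=> ij cs1; apply/matrixP => k l; rewrite givensT// givensE !mxE !eqxx (negPf ij).
move/eqP: ij => ij.
(* Only the diagonal entries at [i] and [j] use [cs1]; the other entries are ring identities, and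
   incompatible index equalities are discarded by [congruence]. *)
case: (eqVneq k l) => [<-|/eqP kl]; case: (eqVneq k j) => [kj|/eqP kj];
  case: (eqVneq k i) => [ki|/eqP ki]; try congruence;
  try (first [by rewrite /=; ring | by apply: (etrans _ cs1); rewrite /=; ring]);
  case: (eqVneq l j) => [lj|/eqP lj]; case: (eqVneq l i) => [li|/eqP li];
  try congruence;
    first [by rewrite /=; ring | by apply: (etrans _ cs1); rewrite /=; ring].
Qed.

End givens.

(** * The spectrum as a function of the Gaussian entries *)

Section spectrum.
Context (R : realType) (n : nat).
Local Notation coords := (coords R ('I_n * 'I_n)%type).

Definition mx_of (w : coords) : 'M[R]_n := \matrix_(i, j) w (i, j).

Definition goe_of (w : coords) : 'M[R]_n :=
  (Num.sqrt (2 * n)%:R)^-1 *: (mx_of w + (mx_of w)^T).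

Definition spectrum_of (M : 'M[R]_n) (w : coords) : n.-tuple R :=
  eigenvalues (M + goe_of w).

Let tr_goe_of w : (goe_of w)^T = goe_of w.
Proof. by rewrite /goe_of linearZ/= linearD/= trmxK addrC. Qed.

Lemma measurable_spectrum_of (M : 'M[R]_n) : M^T = M ->
  measurable_fun [set: coords] (spectrum_of M).
Proof.
move=> symM; apply: measurable_eigenvalues => [i j|w]; last first.
  by rewrite linearD/= symM tr_goe_of.
have -> : (fun w => (M + goe_of w) i j) = (fun w =>
    M i j + (Num.sqrt (2 * n)%:R)^-1 * (w (i, j) + w (j, i))).
  by apply/funext => w; rewrite !mxE.
apply: measurable_funD => //; apply: measurable_funM => //.
by apply: measurable_funD; exact: measurable_coord.
Qed.

End spectrum.

(* Locked to keep unification from unfolding the eigenvalues. *)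
HB.lock Definition spectral_law (R : realType) (n : nat)
    (m : set (coords R ('I_n * 'I_n)%type) -> \bar R) (M : 'M[R]_n)
    (A : set (n.-tuple R)) : \bar R :=
  m (spectrum_of M @^-1` A).

Section rotation_invariance.
Context (R : realType) (n : nat) (m : probability (coords R ('I_n * 'I_n)%type) R).
Hypothesis gm : std_gaussian m.
Local Notation coords := (coords R ('I_n * 'I_n)%type).

Definition preserves (phi : coords -> coords) :=
  measurable_fun [set: coords] phi /\
  forall B, measurable B -> m (phi @^-1` B) = m B.

Lemma preserves_comp phi psi : preserves phi -> preserves psi ->
  preserves (phi \o psi).
Proof.
move=> [mphi Hphi] [mpsi Hpsi]; split; first exact: measurableT_comp.
move=> B mB; rewrite comp_preimage Hpsi ?Hphi//.
by rewrite -[X in measurable X]setTI; exact: mphi.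
Qed.

Lemma preserves_rot2 (p q : 'I_n * 'I_n) (c s : R) : p != q ->
  c ^+ 2 + s ^+ 2 = 1 -> s != 0 -> preserves (rot2 p q c s).
Proof.
move=> pq cs1 s0; split; first exact: measurable_rot2.
move=> B mB; have mr := measurable_rot2 p q c s.
have mB' : measurable (rot2 p q c s @^-1` B : set coords).
  by rewrite -[X in measurable X]setTI; exact: mr.
have mf : measurable_fun setT (fun w : coords => (\1_B w)%:E : \bar R).
  exact/measurable_EFinP/measurable_indic.
have f0 (w : coords) : (0 <= (\1_B w)%:E :> \bar R)%E by rewrite lee_fin.
have := gaussian_rot2 gm pq cs1 s0 mf f0.
rewrite [RHS]integral_indic// setIT => <-.
by rewrite -[in LHS](setIT (_ @^-1` _)) -integral_indic.
Qed.

Definition trc (w : coords) : coords := fun p => w (p.2, p.1).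

(** Transposition permutes the factors of the product that gives the measure of a box. It turns row
    rotations into column rotations. *)
Lemma preserves_trc : preserves trc.
Proof.
have mt : measurable_fun [set: coords] trc.
  by apply: measurable_coordsP => i; exact: measurable_coord.
split=> // B mB.
apply: (std_gaussian_unique (m1 := pushforward m trc)) => // A mA.
rewrite /pushforward.
transitivity (m (box (fun p => A (p.2, p.1)))).
  congr (m _); apply/seteqP; split => w h [i j]; first exact: (h (j, i)).
  by have := h (j, i).
rewrite gm; last by move=> p; exact: mA.
rewrite (reindex_inj (h := fun p : 'I_n * 'I_n => (p.2, p.1)))/=; last first.
  by move=> [a b] [a' b'] [-> ->].
by apply: eq_bigr => -[a b].
Qed.

Definition rot_rows (i j : 'I_n) (c s : R) : coords -> coords :=
  foldr (fun l phi => rot2 (i, l) (j, l) c s \o phi) id (enum 'I_n).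

Lemma mx_of_rot_rows i j c s w : i != j ->
  mx_of (rot_rows i j c s w) = givens i j c s *m mx_of w.
Proof.
move=> ij; apply/matrixP => k l; rewrite givensE !mxE.
(* Generalised to a list [r] of columns: those in [r] have been rotated, the others are untouched,
   so the rotations do not interfere. *)
suff H (r : seq 'I_n) : uniq r ->
   foldr (fun l phi => rot2 (i, l) (j, l) c s \o phi) id r w (k, l) =
   if l \in r then if k == j then c * w (j, l) - s * w (i, l)
                   else if k == i then c * w (i, l) + s * w (j, l)
                   else w (k, l)
   else w (k, l).
  by rewrite /rot_rows H ?enum_uniq// mem_enum.
elim: r k l => //= l' r IH k l /andP[l'r ur].
rewrite /rot2 /upd !IH// !xpair_eqE inE (negPf l'r).
have [->|ll'] := eqVneq l l'; last by rewrite !andbF.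
by rewrite !andbT (negPf l'r).
Qed.

Lemma preserves_rot_rows i j c s : i != j -> c ^+ 2 + s ^+ 2 = 1 -> s != 0 ->
  preserves (rot_rows i j c s).
Proof.
move=> ij cs1 s0; rewrite /rot_rows; elim: (enum 'I_n) => [|l r IH] /=.
  by split => //; exact: measurable_id.
apply: preserves_comp => //; apply: preserves_rot2 => //.
by rewrite xpair_eqE negb_and ij.
Qed.

(** With [O] the rotation, [O G O^T] has the law of [G], and adding its GOE matrix to [O M O^T]
    gives a matrix similar to [M] plus the GOE matrix of [G]. *)
Lemma spectral_law_givens (M : 'M[R]_n) i j c s (A : set (n.-tuple R)) :
  M^T = M -> measurable A -> i != j -> c ^+ 2 + s ^+ 2 = 1 -> s != 0 ->
  spectral_law m (givens i j c s *m M *m (givens i j c s)^T) A = spectral_law m M A.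
Proof.
move=> symM mA ij cs1 s0; rewrite spectral_law.unlock; set O := givens i j c s.
(* On matrices [phi] is [G |-> O G O^T]: the column rotation is a row rotation between two
   transpositions. *)
pose phi := trc \o (rot_rows i j c s \o (trc \o rot_rows i j c s)).
have [_ Hphi] : preserves phi.
  have p1 := preserves_rot_rows ij cs1 s0.
  have p2 := preserves_trc.
  by do 3 apply: preserves_comp => //.
set M' := O *m M *m O^T.
have mB : measurable (spectrum_of M' @^-1` A : set coords).
  rewrite -[X in measurable X]setTI; apply: measurable_spectrum_of => //.
  by rewrite /M' !trmx_mul trmxK symM mulmxA.
have mxtrc u : mx_of (trc u) = (mx_of u)^T by apply/matrixP => k l; rewrite !mxE.
have E w : mx_of (phi w) = O *m mx_of w *m O^T.
  rewrite /phi /= mxtrc mx_of_rot_rows// mxtrc mx_of_rot_rows//.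
  by rewrite !trmx_mul !trmxK.
suff : spectrum_of M = spectrum_of M' \o phi.
  move: (spectrum_of M) (spectrum_of M') mB => S S' mB ->.
  exact: (esym (Hphi _ mB)).
apply/funext => w; rewrite /= /spectrum_of.
rewrite -[LHS](eigenvalues_similar _ (givens_mulT ij cs1)).
congr eigenvalues; rewrite mulmxDr mulmxDl; congr (_ + _).
rewrite /goe_of E -scalemxAr -scalemxAl mulmxDr mulmxDl !trmx_mul !trmxK.
by rewrite mulmxA.
Qed.

End rotation_invariance.

(** * Independence of the spectral law from the unit vector *)

Section unit_vectors.
Context (R : realType) (n : nat).
Context (m : probability (coords R ('I_n.+1 * 'I_n.+1)%type) R).
Hypothesis gm : std_gaussian m.
Implicit Types v : 'cV[R]_n.+1.

Local Notation law := (spectral_law m).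

Lemma mulTmx_norm2 v : norm2 v = 1 -> v^T *m v = 1%:M.
Proof.
move=> v1; apply/matrixP => i j; rewrite !ord1 !mxE eqxx.
have s0 : 0 <= \sum_i v i 0 ^+ 2 by apply: sumr_ge0 => k _; exact: sqr_ge0.
rewrite -[RHS](expr1n _ 2) -v1 /norm2 sqr_sqrtr//.
by apply: eq_bigr => k _; rewrite mxE.
Qed.

(** Givens elimination: a rotation in the plane of coordinates 0 and [h + 1] moves the mass of the
    latter into coordinate 0 and keeps the zeros already made. *)
Lemma spectral_law_rank1_zero (beta : R) (A : set (n.+1.-tuple R)) v : measurable A ->
  v^T *m v = 1%:M -> forall h : nat, (h <= n)%N ->
  exists v', [/\ v'^T *m v' = 1%:M,
    law (beta *: (v' *m v'^T)) A = law (beta *: (v *m v^T)) A &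
    forall k : 'I_n.+1, (0 < k <= h)%N -> v' k 0 = 0].
Proof.
move=> mA v1; elim=> [|h IH] hn.
  by exists v; split => // k; rewrite ltnNge andNb.
have [v' [v'1 v'E v'0]] := IH (ltnW hn).
pose j : 'I_n.+1 := inord h.+1.
have jE : val j = h.+1 by rewrite /j /= inordK.
(* A vanishing coordinate is treated apart: it would give angle zero, whereas the rotation lemma
   asks for [s != 0]. *)
have [b0|b0] := eqVneq (v' j 0) 0.
  exists v'; split => // k /andP[k0]; rewrite leq_eqVlt => /orP[/eqP kh|kh].
    by rewrite (_ : k = j)//; apply/val_inj; rewrite /= jE.
  by apply: v'0; rewrite k0.
pose a := v' 0 0; pose b := v' j 0; pose r := Num.sqrt (a ^+ 2 + b ^+ 2).
have r2 : r ^+ 2 = a ^+ 2 + b ^+ 2.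
  by rewrite sqr_sqrtr// addr_ge0 ?sqr_ge0.
have r0 : r != 0.
  rewrite gt_eqF// sqrtr_gt0 ltr_wpDl ?sqr_ge0//.
  by rewrite lt_neqAle sqr_ge0 eq_sym sqrf_eq0 b0.
pose c := a / r; pose s := b / r.
have cs1 : c ^+ 2 + s ^+ 2 = 1.
  by rewrite /c /s !expr_div_n -mulrDl -r2 divff// sqrf_eq0.
have s0 : s != 0 by rewrite /s mulf_neq0// invr_eq0.
have j0 : 0 != j :> 'I_n.+1 by rewrite -val_eqE/= jE.
have OT1 : (givens 0 j c s)^T *m givens 0 j c s = 1%:M.
  exact/mulmx1C/givens_mulT.
exists (givens 0 j c s *m v'); split.
- by rewrite trmx_mul mulmxA -(mulmxA v'^T) OT1 mulmx1.
- rewrite -v'E -[RHS](spectral_law_givens gm _ mA j0 cs1 s0); last first.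
    by rewrite linearZ/= trmx_mul trmxK.
  by rewrite -scalemxAr -scalemxAl [(_ *m v')^T]trmx_mul !mulmxA.
- move=> k /andP[k0 kh]; rewrite givensE.
  case: eqP => [_|kj]; first by rewrite -/a -/b /c /s; field.
  rewrite (_ : (k == 0) = false); last by rewrite -val_eqE/= gtn_eqF.
  apply: v'0; rewrite k0 /= -ltnS ltn_neqAle kh andbT.
  by apply/eqP => kh'; apply/kj/val_inj; rewrite /= jE.
Qed.

Lemma spectral_law_rank1_unit (beta : R) (A : set (n.+1.-tuple R)) u v : measurable A ->
  norm2 u = 1 -> norm2 v = 1 ->
  law (beta *: (u *m u^T)) A = law (beta *: (v *m v^T)) A.
Proof.
move=> mA /mulTmx_norm2 u1 /mulTmx_norm2 v1.
have [u' [u'1 <- u'0]] := spectral_law_rank1_zero beta mA u1 (leqnn n).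
have [v' [v'1 <- v'0]] := spectral_law_rank1_zero beta mA v1 (leqnn n).
(* The eliminated vector is plus or minus the first basis vector, and the sign disappears in
   [w *m w^T]. *)
suff H (w : 'cV[R]_n.+1) : w^T *m w = 1%:M ->
    (forall k : 'I_n.+1, (0 < k <= n)%N -> w k 0 = 0) ->
    w *m w^T = delta_mx 0 0.
  by rewrite !H.
move=> w1 w0; have w0' (k : 'I_n.+1) : k != 0 -> w k 0 = 0.
  by move=> k0; apply: w0; rewrite lt0n -(inj_eq val_inj) in k0 *; rewrite k0 -ltnS/=.
have w00 : w 0 0 * w 0 0 = 1.
  move/matrixP: w1 => /(_ 0 0); rewrite !mxE eqxx => h; rewrite -[RHS]h.
  rewrite (bigD1 0)//= mxE big1 ?addr0// => k /w0' wk.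
  by rewrite wk mulr0.
apply/matrixP => k l; rewrite !mxE big_ord1 !mxE.
have [->|k0] := eqVneq k 0; last by rewrite w0' ?mul0r.
have [->|l0] := eqVneq l 0; last by rewrite (w0' l) ?mulr0.
by rewrite w00.
Qed.

End unit_vectors.

(** * Exponential moments of sums of signs *)

Section rademacher.
Context (R : realType).

(** This is [tanh x <= x] without division. The difference [f] vanishes at 0 and has derivative
    [y * (expR y - expR (- y))], positive for [y > 0]. *)
Lemma tanh_le (x : R) : 0 <= x -> expR x - expR (- x) <= x * (expR x + expR (- x)).
Proof.
rewrite le_eqVlt => /predU1P[<-|x0]; first by rewrite oppr0 subrr mul0r.
pose f (y : R) := y * (expR y + expR (- y)) - (expR y - expR (- y)).
have fd (y : R) : is_derive y 1 f (y * (expR y - expR (- y))).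
  rewrite /f; apply: is_derive_eq.
  by rewrite !scaler1 /GRing.scale/=; ring.
have cf : {within `[0, x], continuous f}.
  by apply: derivable_within_continuous => y _; exact: ex_derive.
have [c /[!in_itv]/= /andP[c0 cx]] := MVT x0 (fun y _ => fd y) cf.
rewrite {2}/f mul0r oppr0 subrr !(subr0, oppr0, addr0) => fx.
rewrite -subr_ge0 -/(f x) fx ltW// !mulr_gt0// subr_gt0 ltr_expR.
by rewrite (lt_trans _ c0)// oppr_lt0.
Qed.

(** The quotient [f] of the left side by [expR (y ^+ 2 / 2)] equals 2 at 0, and [tanh_le] makes its
    derivative nonpositive for [y >= 0]; parity gives negative [x]. *)
Lemma cosh_le (x : R) : expR x + expR (- x) <= 2 * expR (x ^+ 2 / 2).
Proof.
wlog x0 : x / 0 <= x.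
  move=> H; have [/H//|/ltW x0] := leP 0 x.
  by have := H (- x); rewrite oppr_ge0 opprK sqrrN addrC; exact.
move: x0; rewrite le_eqVlt => /predU1P[<-|x0].
  by rewrite oppr0 expr0n/= mul0r expR0 mulr1.
pose f (y : R) := expR (- (y * y / 2)) * (expR y + expR (- y)).
have fd (y : R) : is_derive y 1 f
    (expR (- (y * y / 2)) * (expR y - expR (- y) - y * (expR y + expR (- y)))).
  rewrite /f; apply: is_derive_eq.
  by rewrite !scaler1 /GRing.scale/=; field.
have cf : {within `[0, x], continuous f}.
  by apply: derivable_within_continuous => y _; exact: ex_derive.
have [c /[!in_itv]/= /andP[c0 cx]] := MVT x0 (fun y _ => fd y) cf.
rewrite {2}/f !mul0r !oppr0 expR0 mul1r => fx.
have : f x - (1 + 1) <= 0.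
  rewrite fx addr0 mulr_le0_ge0 ?(ltW x0)//.
  by rewrite mulr_ge0_le0 ?expR_ge0// subr_le0 tanh_le// ltW.
by rewrite subr_le0 /f expRN mulrC ler_pdivrMr ?expR_gt0// expr2.
Qed.

(** The sum over sign patterns factorises into hyperbolic cosines, each bounded by [cosh_le]. *)
Lemma rademacher_mgf (I : finType) (t : I -> R) :
  \sum_(e : {ffun I -> bool}) expR (\sum_i t i * (-1) ^+ e i) <=
  2 ^+ #|I| * expR (\sum_i t i ^+ 2 / 2).
Proof.
under eq_bigr do rewrite expR_sum.
rewrite -(bigA_distr_bigA (fun i (b : bool) => expR (t i * (-1) ^+ b)))/=.
rewrite expR_sum -prodr_const -big_split/=; apply: ler_prod => i _.
rewrite big_bool/= expr0 expr1 mulr1 mulrN1 addr_ge0 ?expR_ge0//=.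
by rewrite addrC cosh_le.
Qed.

(** Write [expR (th ^+ 2 * S ^+ 2 / 2)] as the mean of [expR (th * S * x)] over a standard normal
    [x]. The exponent is now linear in the signs, so [rademacher_mgf] applies under the integral and
    leaves [expR (b * x ^+ 2 / 2)]. *)
Lemma rademacher_exp_sqr (I : finType) (a : I -> R) (b : R) : (0 < #|I|)%N ->
  (forall i, a i ^+ 2 = 1) -> 0 <= b -> b < 1 ->
  \sum_(e : {ffun I -> bool})
    expR (b / (2 * #|I|%:R) * (\sum_i a i * (-1) ^+ e i) ^+ 2) <=
  2 ^+ #|I| * (Num.sqrt (1 - b))^-1.
Proof.
move=> I0 a1 b0 b1; rewrite -lee_fin.
(* Chosen so that [th ^+ 2 / 2] is the coefficient [b / (2 * #|I|)] of the square. *)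
pose th := Num.sqrt (b / #|I|%:R).
have I0' : 0 < #|I|%:R :> R by rewrite ltr0n.
have th2 : th ^+ 2 = b / #|I|%:R by rewrite sqr_sqrtr// divr_ge0// ltW.
pose S (e : {ffun I -> bool}) := \sum_i a i * (-1) ^+ e i.
have mexp c : measurable_fun [set: R] (fun x : R => (expR (c * x))%:E).
  by apply/measurable_EFinP; apply: measurableT_comp => //; exact: measurable_funM.
have mexp2 : measurable_fun [set: R] (fun x : R => expR (b * x ^+ 2 / 2)).
  apply: measurableT_comp => //; apply: measurable_funM => //.
  by apply: measurable_funM => //; exact: measurable_funX.
rewrite [leLHS](_ : _ = \int[normal_prob 0 1]_x
    (\sum_e (expR (th * S e * x))%:E))%E; last first.
  rewrite ge0_integral_sum//; last by move=> e; exact: mexp.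
  rewrite -sumEFin; apply: eq_bigr => e _; rewrite gaussian_mgf.
  congr (expR _)%:E; rewrite exprMn th2 /S; field.
  by rewrite gt_eqF.
rewrite [leRHS](_ : _ = \int[normal_prob 0 1]_x
    ((2 ^+ #|I|)%:E * (expR (b * x ^+ 2 / 2))%:E))%E; last first.
  rewrite ge0_integralZl_EFin//.
  - by rewrite gaussian_exp_sqr.
  - exact/measurable_EFinP.
apply: ge0_le_integral => //.
- by move=> x _; apply: sume_ge0 => e _; rewrite lee_fin expR_ge0.
- by apply: emeasurable_sum => e; exact: mexp.
- by apply: emeasurable_funM => //; exact/measurable_EFinP.
move=> x _; rewrite sumEFin -EFinM lee_fin.
have := rademacher_mgf (fun i => th * x * a i).
congr (_ <= _).
  apply: eq_bigr => e _; congr expR; rewrite /S mulr_sumr mulr_suml.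
  by apply: eq_bigr => i _; ring.
congr (_ * expR _).
under eq_bigr do rewrite exprMn a1 mulr1 exprMn th2.
rewrite sumr_const -mulr_natr; field.
by rewrite gt_eqF.
Qed.

End rademacher.

(** * Second moment of the likelihood ratio *)

Section likelihood.
Context (R : realType) (I : finType) (m : probability (coords R I) R).
Hypothesis gm : std_gaussian m.

Definition likelihood (M : I -> R) (w : coords R I) : R :=
  expR (\sum_i (M i * w i - M i ^+ 2 / 2)).

Lemma measurable_likelihood (M : I -> R) :
  measurable_fun [set: coords R I] (likelihood M).
Proof.
apply: measurableT_comp => //; apply: measurable_sum => i.
apply: measurable_funB => //; apply: measurable_funM => //.
exact: measurable_coord.
Qed.

(** The product of the two likelihood ratios is [expR] of the inner product times the ratio for
    [M + M'], which has mean one. *)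
Lemma integral_likelihoodM (M M' : I -> R) :
  (\int[m]_w (likelihood M w * likelihood M' w)%:E =
   (expR (\sum_i M i * M' i))%:E)%E.
Proof.
pose D i := M i + M' i.
have mD := measurable_likelihood D.
have h : (\int[m]_w (likelihood D w)%:E = 1)%E.
  have m1 : measurable_fun setT (cst 1%E : coords R I -> \bar R).
    exact: measurable_cst.
  have := cameron_martin gm D m1 (fun=> lee01).
  rewrite [X in X = _](_ : _ = 1)%E => [->|].
    by apply: eq_integral => w _; rewrite mul1e.
  by rewrite integral_cst// mul1e; exact: probability_setT.
transitivity (\int[m]_w ((expR (\sum_i M i * M' i))%:E * (likelihood D w)%:E))%E.
  apply: eq_integral => w _; rewrite -!EFinM /likelihood -!expRD -!big_split/=.
  by congr (expR _)%:E; apply: eq_bigr => i _; rewrite /D; field.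
rewrite ge0_integralZl_EFin ?expR_ge0//.
- by rewrite h mule1.
- by move=> w _; rewrite lee_fin expR_ge0.
- exact/measurable_EFinP.
Qed.

End likelihood.

(** * Averaging the likelihood ratio over sign vectors *)

Section second_moment.
Context (R : realType) (n : nat).
Context (m : probability (coords R ('I_n.+1 * 'I_n.+1)%type) R).
Hypothesis gm : std_gaussian m.
Local Notation N := (n.+1%:R : R).
Local Notation signs := {ffun 'I_n.+1 -> bool}.
Local Notation coords := (coords R ('I_n.+1 * 'I_n.+1)%type).

Definition sign_vec (e : signs) : 'cV[R]_n.+1 := \col_i ((Num.sqrt N)^-1 * (-1) ^+ e i).

Lemma norm2_sign_vec e : norm2 (sign_vec e) = 1.
Proof.
rewrite /norm2 (eq_bigr (fun=> N^-1)) => [|i _]; last first.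
  by rewrite mxE exprMn exprVn sqr_sqrtr// -exprM mulnC exprM sqrrN expr1n expr1n mulr1.
by rewrite sumr_const card_ord -[N^-1 *+ _]mulr_natr mulVf ?sqrtr1// pnatr_eq0.
Qed.

(** The shift is applied to [G], not to the GOE matrix: symmetrising doubles it and rescaling
    divides it by [Num.sqrt (2 * N)], so it becomes [beta / N] times the product of the signs. *)
Definition spike_shift (beta : R) (e : signs) (p : 'I_n.+1 * 'I_n.+1) : R :=
  beta / Num.sqrt (2 * N) * ((-1) ^+ e p.1 * (-1) ^+ e p.2).

Lemma spectrum_of_shift beta e (w : coords) :
  spectrum_of 0 (fun p => w p + spike_shift beta e p) =
  spectrum_of (beta *: (sign_vec e *m (sign_vec e)^T)) w.
Proof.
rewrite /spectrum_of; congr eigenvalues; apply/matrixP => i j.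
rewrite !mxE big_ord1 !mxE add0r /spike_shift/=.
have N0 : 0 < N by rewrite ltr0n.
have s2 : Num.sqrt (2 * N) ^+ 2 = 2 * N by rewrite sqr_sqrtr// mulr_ge0// ltW.
have sN : Num.sqrt N ^+ 2 = N by rewrite sqr_sqrtr// ltW.
have r0 : Num.sqrt (2 * N) != 0 by rewrite gt_eqF// sqrtr_gt0 mulr_gt0.
have rN0 : Num.sqrt N != 0 by rewrite gt_eqF// sqrtr_gt0.
rewrite natrM.
set r := Num.sqrt (2 * N) in s2 r0 *; set q := Num.sqrt N in sN rN0 *.
set a := (-1) ^+ e i; set b := (-1) ^+ e j.
transitivity (r^-1 * (w (i, j) + w (j, i)) + 2 * beta * (a * b) / r ^+ 2).
  by field.
transitivity (beta * (a * b) / q ^+ 2 + r^-1 * (w (i, j) + w (j, i)));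
  last by [field; rewrite rN0 r0].
rewrite s2 sN addrC; congr (_ + _).
by move: N N0 => x x0; field; rewrite gt_eqF.
Qed.

Lemma spike_shift_inner beta e e' :
  \sum_p spike_shift beta e p * spike_shift beta e' p =
  beta ^+ 2 / (2 * N) * (\sum_i (-1) ^+ e i * (-1) ^+ e' i) ^+ 2.
Proof.
rewrite [(\sum_i _) ^+ 2]expr2 big_distrlr/= pair_bigA mulr_sumr/=.
apply: eq_bigr => -[i j] _ /=.
rewrite /spike_shift /= -[in RHS](@sqr_sqrtr _ (2 * N)) ?mulr_ge0//.
by field; rewrite gt_eqF// sqrtr_gt0 mulr_gt0// ltr0n.
Qed.

Lemma spectral_law_sign_vec beta e (A : set (n.+1.-tuple R)) : measurable A ->
  (spectral_law m (beta *: (sign_vec e *m (sign_vec e)^T)) A =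
   \int[m]_w ((\1_A (spectrum_of 0 w))%:E * (likelihood (spike_shift beta e) w)%:E))%E.
Proof.
move=> mA; rewrite spectral_law.unlock.
have mS : measurable_fun setT (spectrum_of 0 : coords -> _).
  by apply: measurable_spectrum_of; rewrite trmx0.
pose f (w : coords) : \bar R := (\1_A (spectrum_of 0 w))%:E.
have mf : measurable_fun setT f.
  by apply/measurable_EFinP; exact: (measurableT_comp (measurable_indic mA) mS).
have f0 w : (0 <= f w)%E by rewrite lee_fin.
have := cameron_martin gm (spike_shift beta e) mf f0.
move=> /= <-.
set S := spectrum_of _.
have mSA : measurable (S @^-1` A : set coords).
  rewrite -[X in measurable X]setTI; apply: measurable_spectrum_of => //.
  by rewrite linearZ/= trmx_mul trmxK.
transitivity (\int[m]_w (\1_(S @^-1` A) w)%:E)%E.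
  by rewrite integral_indic// setIT.
by apply: eq_integral => w _; rewrite /f spectrum_of_shift.
Qed.

(** The averaged likelihood ratio has second moment at most [(1 - beta^2)^(-1/2)], whatever the
    dimension. The free parameter [t] replaces Cauchy-Schwarz and avoids square roots of
    probabilities. *)
Lemma spectral_law_le beta v (A : set (n.+1.-tuple R)) (t : R) : measurable A ->
  0 <= beta < 1 -> norm2 v = 1 -> 0 < t ->
  (spectral_law m (beta *: (v *m v^T)) A <=
   (t / 2 * (Num.sqrt (1 - beta ^+ 2))^-1)%:E + (2 * t)^-1%:E * spectral_law m 0 A)%E.
Proof.
move=> mA /andP[b0 b1] v1 t0.
pose K : R := 2 ^+ n.+1.
have K0 : 0 < K by rewrite exprn_gt0.
pose C := (Num.sqrt (1 - beta ^+ 2))^-1.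
pose lik e (w : coords) := likelihood (spike_shift beta e) w.
have mlik e : measurable_fun setT (lik e) := measurable_likelihood _.
have lik0 e w : 0 <= lik e w := expR_ge0 _.
(* The unnormalised sum, [K] times the average; this explains the powers of [K] below. *)
pose L w := \sum_e lik e w.
have mL : measurable_fun [set: coords] L by exact: measurable_sum.
have L0 w : 0 <= L w by exact: sumr_ge0.
pose f (w : coords) : R := \1_A (spectrum_of 0 w).
have mS : measurable_fun setT (spectrum_of 0 : coords -> n.+1.-tuple R).
  by apply: measurable_spectrum_of; rewrite trmx0.
have mf : measurable_fun setT f.
  exact: (measurableT_comp (measurable_indic mA) mS).
have f0 w : 0 <= f w by [].
(* All [K] sign vectors give the same law as [v], so their [K] Cameron-Martin formulas may be added
   up. *)
have E1 : (K%:E * spectral_law m (beta *: (v *m v^T)) A = \int[m]_w (f w * L w)%:E)%E.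
  transitivity (\sum_(e : signs) 1%:E * spectral_law m (beta *: (v *m v^T)) A)%E.
    rewrite -ge0_sume_distrl ?sumEFin; last by move=> *; rewrite lee01.
    by congr (_%:E * _)%E; rewrite sumr_const card_ffun card_bool card_ord natrX.
  under eq_bigr => e _.
    rewrite mul1e (spectral_law_rank1_unit gm beta mA v1 (norm2_sign_vec e)).
    rewrite spectral_law_sign_vec//.
    over.
  rewrite -ge0_integral_sum//.
  - apply: eq_integral => w _; rewrite /L mulr_sumr -sumEFin.
    by apply: eq_bigr => e _; rewrite EFinM.
  - move=> e; apply: emeasurable_funM; first exact/measurable_EFinP.
    by apply/measurable_EFinP; exact: mlik.
  - by move=> e w _; rewrite mule_ge0 ?lee_fin ?expR_ge0//.
(* Expand the square over pairs of sign vectors. For each fixed [e], the sum over [e'] is bounded by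
   [rademacher_exp_sqr] with coefficients [(-1) ^+ e i] and [b = beta ^+ 2]. *)
have E2 : (\int[m]_w (L w ^+ 2)%:E <= (K * (K * C))%:E)%E.
  pose liks (p : signs * signs) w := lik p.1 w * lik p.2 w.
  rewrite (eq_integral (fun w => \sum_p (liks p w)%:E))%E; last first.
    move=> w _; rewrite sumEFin expr2 /L big_distrlr /=.
    by rewrite (pair_bigA _ (fun e e' => lik e w * lik e' w)).
  rewrite ge0_integral_sum//; last 2 first.
  - by move=> p; apply/measurable_EFinP; exact: measurable_funM.
  - by move=> p w _; rewrite lee_fin mulr_ge0.
  rewrite (eq_bigr (fun p : signs * signs => (expR (beta ^+ 2 / (2 * N) *
      (\sum_i (-1) ^+ p.1 i * (-1) ^+ p.2 i) ^+ 2))%:E)) => [|p _]; last first.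
    by rewrite (integral_likelihoodM gm) spike_shift_inner.
  rewrite sumEFin lee_fin -(pair_bigA _ (fun e e' : signs => expR (beta ^+ 2 / (2 * N) *
      (\sum_i (-1) ^+ e i * (-1) ^+ e' i) ^+ 2)))/=.
  apply: (@le_trans _ _ (\sum_(e : signs) K * C)).
    apply: ler_sum => e _.
    have := @rademacher_exp_sqr R 'I_n.+1 (fun i => (-1) ^+ e i) (beta ^+ 2).
    rewrite card_ord; apply=> //; first by move=> i; exact: sqrr_sign.
      exact: sqr_ge0.
    by rewrite expr_lt1.
  by rewrite sumr_const card_ffun card_bool card_ord -mulr_natl natrX.
have E3 : (\int[m]_w (f w)%:E = spectral_law m 0 A)%E.
  rewrite spectral_law.unlock.
  have mSA : measurable (spectrum_of 0 @^-1` A : set coords).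
    by rewrite -[X in measurable X]setTI; exact: mS.
  by rewrite -[in RHS](setIT (_ @^-1` _)) -integral_indic.
have c10 : 0 <= t / (2 * K) by rewrite divr_ge0 ?mulr_ge0// ltW.
have c20 : 0 <= K / (2 * t) by rewrite divr_ge0 ?mulr_ge0// ltW.
have mL2 : measurable_fun [set: coords] (fun w => (L w ^+ 2)%:E).
  by apply/measurable_EFinP; exact: measurable_funX.
have mfE : measurable_fun [set: coords] (fun w => (f w)%:E) by exact/measurable_EFinP.
(* AM-GM: [1_A L <= t L^2 / (2 K) + K 1_A / (2 t)] *)
have H : (\int[m]_w (f w * L w)%:E <=
    \int[m]_w ((t / (2 * K))%:E * (L w ^+ 2)%:E + (K / (2 * t))%:E * (f w)%:E))%E.
  apply: ge0_le_integral => //.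
  - by move=> w _; rewrite lee_fin mulr_ge0.
  - by apply/measurable_EFinP; exact: measurable_funM.
  - by apply: emeasurable_funD; exact: emeasurable_funM.
  move=> w _; rewrite -!EFinM -EFinD lee_fin.
  have : f w = 0 \/ f w = 1 by rewrite /f indicE; case: (_ \in _); [right|left].
  move=> [->|->]; first by rewrite mul0r mulr0 addr0 mulr_ge0 ?sqr_ge0.
  rewrite mul1r mulr1 -subr_ge0.
  rewrite (_ : _ - _ = (t * L w - K) ^+ 2 / (2 * K * t)).
    by rewrite divr_ge0 ?sqr_ge0// !mulr_ge0// ltW.
  by field; rewrite (gt_eqF K0) (gt_eqF t0).
move: H; rewrite -E1 ge0_integralD//; last 4 first.
- by move=> w _; rewrite -EFinM lee_fin mulr_ge0// sqr_ge0.
- exact: emeasurable_funM.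
- by move=> w _; rewrite -EFinM lee_fin mulr_ge0.
- exact: emeasurable_funM.
rewrite ge0_integralZl_EFin//; last by move=> w _; rewrite lee_fin sqr_ge0.
rewrite ge0_integralZl_EFin//; last by move=> w _; rewrite lee_fin.
rewrite E3 => H.
have q00 : (0 <= spectral_law m 0 A)%E by rewrite spectral_law.unlock.
rewrite -(@lee_pmul2l _ K%:E)//.
apply: (le_trans H).
have C0 : 0 <= C by rewrite invr_ge0 sqrtr_ge0.
have h1 : (0 <= (t / 2 * C)%:E)%E by rewrite lee_fin mulr_ge0// divr_ge0// ltW.
have h2 : (0 <= (2 * t)^-1%:E * spectral_law m 0 A)%E.
  by rewrite mule_ge0// lee_fin invr_ge0 mulr_ge0// ltW.
rewrite (ge0_muleDr K%:E h1 h2).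
apply: leeD.
  apply: (le_trans (lee_wpmul2l _ E2)); first by rewrite lee_fin.
  rewrite -!EFinM lee_fin le_eqVlt; apply/orP; left; apply/eqP.
  rewrite -/C; field; exact: (negbT (gt_eqF K0)).
by rewrite muleA -EFinM.
Qed.

End second_moment.

(** * Contiguity *)

Section joint_law.
Context d (T : measurableType d) (R : realType) (P : probability T R) (n : nat).
Variable G : 'I_n -> 'I_n -> {RV P >-> R}.
Local Notation coords := (coords R ('I_n * 'I_n)%type).

Definition entries (w : T) : coords := fun p => G p.1 p.2 w.

Lemma measurable_entries : measurable_fun [set: T] entries.
Proof. by apply: measurable_coordsP => p; exact: measurable_funP. Qed.

HB.instance Definition _ := isMeasurableFun.Build _ _ _ _ entries measurable_entries.

Definition entries_law : probability coords R := distribution P entries.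

Lemma std_gaussian_entries : iid_standard_normal G -> std_gaussian entries_law.
Proof.
move=> [normG indepG] A mA; rewrite /entries_law /= /distribution /pushforward.
have := indepG [set: 'I_n * 'I_n]%SET A mA.
rewrite (_ : \bigcap_(i in _) _ = entries @^-1` box A); last first.
  apply/seteqP; split => w h p; first by apply: h; rewrite /= inE.
  by move=> _; exact: h.
move=> ->; apply: eq_big => [p|p _]; first by rewrite inE.
exact: (normG p.1 p.2).
Qed.

Lemma spectrum_of_entries (M : 'M[R]_n) (w : T) :
  spectrum_of M (entries w) = eigenvalues (M + goe_mx G w).
Proof.
by congr (eigenvalues (_ + _ *: _)).
Qed.

Lemma goe_spectral_lawE (A : set (n.-tuple R)) :
  goe_spectral_law G A = spectral_law entries_law 0 A.
Proof.
have E : goe_eigenvalues G = spectrum_of 0 \o entries.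
  by apply/funext => w; rewrite /= spectrum_of_entries add0r.
rewrite spectral_law.unlock; transitivity (P (goe_eigenvalues G @^-1` A)); first by [].
by move: (spectrum_of 0) E => S ->.
Qed.

Lemma spiked_spectral_lawE (beta : R) v (A : set (n.-tuple R)) :
  spiked_spectral_law beta v G A = spectral_law entries_law (beta *: (v *m v^T)) A.
Proof.
have E : spiked_eigenvalues beta v G = spectrum_of (beta *: (v *m v^T)) \o entries.
  by apply/funext => w; rewrite /= spectrum_of_entries.
rewrite spectral_law.unlock.
transitivity (P (spiked_eigenvalues beta v G @^-1` A)); first by [].
by move: (spectrum_of _) E => S ->.
Qed.

End joint_law.

(** Monotonicity in [beta] replaces it by [rho], which makes the constant uniform in [n]. *)
Lemma spiked_spectral_law_le d (T : measurableType d) (R : realType)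
    (P : probability T R) (n : nat) (G : 'I_n -> 'I_n -> {RV P >-> R})
    (beta rho t : R) v (A : set (n.-tuple R)) :
  iid_standard_normal G -> (0 < n)%N -> measurable A -> 0 <= beta <= rho -> rho < 1 ->
  norm2 v = 1 -> 0 < t ->
  (spiked_spectral_law beta v G A <=
   (t / 2 * (Num.sqrt (1 - rho ^+ 2))^-1)%:E + (2 * t)^-1%:E * goe_spectral_law G A)%E.
Proof.
case: n G v A => // n G v A iidG _ mA /andP[b0 brho] rho1 v1 t0.
have b1 : beta < 1 := le_lt_trans brho rho1.
have rho0 : 0 <= rho := le_trans b0 brho.
rewrite goe_spectral_lawE spiked_spectral_lawE.
apply: le_trans (spectral_law_le (std_gaussian_entries iidG) mA _ v1 t0) _.
  by rewrite b0 b1.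
apply: leeD2r; rewrite lee_fin ler_wpM2l ?divr_ge0 ?(ltW t0)//.
have rho2 : 0 < 1 - rho ^+ 2 by rewrite subr_gt0 expr_lt1.
have br2 : 1 - rho ^+ 2 <= 1 - beta ^+ 2.
  by rewrite lerB// ler_pXn2r// nnegrE.
rewrite lef_pV2 ?posrE ?sqrtr_gt0 ?(lt_le_trans rho2)//.
exact: ler_wsqrtr.
Qed.

Lemma limn_esup_lt1 (R : realType) (u : nat -> R) :
  (limn_esup (fun n => (u n)%:E) < 1)%E ->
  exists2 rho, rho < 1 & \forall n \near \oo, u n <= rho.
Proof.
move=> /ereal_inf_lt[_ [A ooA <-]] sup1.
have ub n : A n -> ((u n)%:E <= ereal_sup [set (u k)%:E | k in A])%E.
  by move=> An; apply: ereal_sup_ubound; exists n.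
case: (ereal_sup _) sup1 ub => [r| |]// => [r1 ub|_ ub].
  by exists r => //; apply: filterS ooA => n /ub; rewrite lee_fin.
(* A supremum equal to [-oo] leaves no index in [A], so any bound below 1 serves. *)
exists 0 => //; apply: filterS ooA => n /ub.
by rewrite leeNy_eq.
Qed.

(** For fixed [t] the second term tends to 0 along the events, so the upper limit of the [Q1]
    probabilities is at most [t * C / 2], with [t] arbitrarily small. *)
Lemma contiguous_quadratic (R : realType) (d : nat -> measure_display)
    (T : forall n, measurableType (d n)) (Q1 Q0 : forall n, probability (T n) R)
    (C : R) : 0 <= C ->
  (forall t, 0 < t -> \forall n \near \oo, forall A, measurable A ->
     (Q1 n A <= (t / 2 * C)%:E + (2 * t)^-1%:E * Q0 n A)%E) ->
  contiguous Q1 Q0.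
Proof.
move=> C0 H A mA /fine_cvgP[_ /cvgrPdist_le Q0A].
apply/fine_cvgP; split; first by near=> n; exact: fin_num_measure.
apply/cvgrPdist_le => e e0 /=.
(* [C + 1] is positive even when [C = 0]. The first term is then at most [e / 2], and [Q0 <= e * t]
   makes the second at most [e / 2]. *)
pose t := e / (C + 1).
have C1 : 0 < C + 1 by rewrite ltr_wpDl.
have t0 : 0 < t by rewrite divr_gt0.
have et0 : 0 < e * t by rewrite mulr_gt0.
near=> n.
have Q1n : Q1 n (A n) \is a fin_num by exact: fin_num_measure.
have Q0n : Q0 n (A n) \is a fin_num by exact: fin_num_measure.
have q10 : 0 <= fine (Q1 n (A n)) by rewrite fine_ge0.
have h0 : fine (Q0 n (A n)) <= e * t.
  rewrite -[leLHS]ger0_norm ?fine_ge0// -[X in `|X|]opprK normrN -sub0r.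
  by near: n; exact: Q0A.
have : (Q1 n (A n) <= (t / 2 * C)%:E + (2 * t)^-1%:E * Q0 n (A n))%E.
  by have := mA n; move: (A n); near: n; exact: H.
rewrite -(fineK Q1n) -(fineK Q0n) -EFinM -EFinD lee_fin => h1.
rewrite sub0r normrN ger0_norm//.
apply: (le_trans h1).
apply: (@le_trans _ _ (t / 2 * (C + 1) + (2 * t)^-1 * (e * t))).
  apply: lerD; last by rewrite ler_wpM2l// invr_ge0 mulr_ge0// ltW.
  by rewrite ler_wpM2l ?divr_ge0 ?lerDl// ltW.
rewrite le_eqVlt; apply/orP; left; apply/eqP.
by rewrite /t; field; rewrite (gt_eqF C1) (gt_eqF e0).
Unshelve. all: by end_near. Qed.

Lemma contiguous_spiked (R : realType) (d : nat -> measure_display)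
    (T : forall n, measurableType (d n)) (P : forall n, probability (T n) R)
    (G : forall n, 'I_n -> 'I_n -> {RV (P n) >-> R})
    (beta : nat -> R) (v : forall n, 'cV[R]_n) :
  (forall n, iid_standard_normal (G n)) ->
  (forall n, (0 < n)%N -> 0 <= beta n) ->
  (forall n, (0 < n)%N -> norm2 (v n) = 1) ->
  (limn_esup (fun n => (beta n)%:E) < 1%:E)%E ->
  spectrally_contiguous (fun n => spiked_spectral_law (beta n) (v n) (G n))
    (fun n => goe_spectral_law (G n)).
Proof.
move=> iidG beta0 v1 /limn_esup_lt1[rho rho1 beta_rho].
apply: (@contiguous_quadratic R _ _ _ _ (Num.sqrt (1 - rho ^+ 2))^-1).
  by rewrite invr_ge0.
move=> t t0; near=> n => A mA.
have n0 : (0 < n)%N by near: n; exists 1%N.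
apply: spiked_spectral_law_le => //; last exact: v1.
by rewrite beta0//=; near: n.
Unshelve. all: by end_near. Qed.

Lemma norm2_indicator_vec (R : realType) n (U : {set 'I_n}) : (0 < #|U|)%N ->
  norm2 ((Num.sqrt #|U|%:R)^-1 *: indicator_vec R U) = 1.
Proof.
move=> U0; rewrite /norm2.
have UE : \sum_(i < n) ((i \in U)%:R ^+ 2 : R) = #|U|%:R.
  rewrite -sum1_card natr_sum [RHS]big_mkcond; apply: eq_bigr => i _.
  by case: (i \in U); rewrite ?expr1n ?expr0n.
under eq_bigr do rewrite !mxE exprMn exprVn sqr_sqrtr//.
by rewrite -mulr_sumr UE mulVf ?sqrtr1// pnatr_eq0 -lt0n.
Qed.

Lemma indicator_spike (R : realType) n (U : {set 'I_n}) : (0 < #|U|)%N ->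
  let v := (Num.sqrt #|U|%:R)^-1 *: indicator_vec R U in
  (Num.sqrt n%:R)^-1 *: (indicator_vec R U *m (indicator_vec R U)^T) =
  (#|U|%:R / Num.sqrt n%:R) *: (v *m v^T).
Proof.
move=> U0 v; rewrite /v linearZ/= -scalemxAl -scalemxAr !scalerA; congr (_ *: _).
rewrite mulrAC -!mulrA -invfM -expr2 sqr_sqrtr// mulrCA divff ?mulr1//.
by rewrite pnatr_eq0 -lt0n.
Qed.

Theorem theorem1 (R : realType) (d : nat -> measure_display)
    (T : forall n : nat, measurableType (d n))
    (P : forall n : nat, probability (T n) R)
    (G : forall n : nat, 'I_n -> 'I_n -> {RV (P n) >-> R})
    (iidG : forall n : nat, iid_standard_normal (G n)) :
  (forall (L : nat -> nat) (U : forall n : nat, {set 'I_n}),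
     (forall n : nat, (0 < n)%N -> (1 <= L n <= n)%N) ->
     (forall n : nat, (0 < n)%N -> #|U n| = L n) ->
     (limn_esup (fun n : nat => ((L n)%:R / Num.sqrt n%:R : R)%:E) < 1%:E)%E ->
     spectrally_contiguous
       (fun n => spiked_spectral_law (Num.sqrt n%:R)^-1
                   (indicator_vec R (U n)) (G n))
       (fun n => goe_spectral_law (G n)))
  /\
  (forall (beta : nat -> R) (v : forall n : nat, 'cV[R]_n),
     (forall n : nat, (0 < n)%N -> 0 <= beta n) ->
     (forall n : nat, (0 < n)%N -> norm2 (v n) = 1) ->
     (limn_esup (fun n : nat => (beta n)%:E) < 1%:E)%E ->
     spectrally_contiguous
       (fun n => spiked_spectral_law (beta n) (v n) (G n))
       (fun n => goe_spectral_law (G n))).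
Proof.
split=> [L U LP UL limL|beta v beta0 v1 limb]; last exact: contiguous_spiked.
pose v n := (Num.sqrt #|U n|%:R)^-1 *: indicator_vec R (U n).
have U0 n : (0 < n)%N -> (0 < #|U n|)%N.
  by move=> n0; rewrite UL//; have /andP[] := LP n n0.
have H : spectrally_contiguous
    (fun n => spiked_spectral_law ((L n)%:R / Num.sqrt n%:R) (v n) (G n))
    (fun n => goe_spectral_law (G n)).
  apply: contiguous_spiked => // n n0.
  by apply: norm2_indicator_vec; exact: U0.
(* The two descriptions of the spike are identified for [n > 0], where [U n] is nonempty; eventual
   equality is enough for the limit. *)
move=> A mA /(H A mA); apply: cvg_trans; apply: near_eq_cvg; near=> n.
have n0 : (0 < n)%N by near: n; exists 1%N.
have E beta u := spiked_spectral_lawE (G n) beta u (A n).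
by rewrite !E indicator_spike ?U0// -(UL n n0).
Unshelve. all: by end_near. Qed.
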